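(* Let $n\geqslant 1$, let $\lambda$ be a partition of $n$, let $\mathcal T$ be a standard $\lambda$-tableau, and for $k=1,\dots,n$ let $\sigma_k=q^{2(j-i)}$, where $(i,j)$ (row $i$, column $j$) is the cell of $\mathcal T$ occupied by $k$. Let $$f(\lambda)=\prod_{\alpha\in\lambda}\frac{q^{c_\alpha}}{[h_\alpha]_q},$$ and let $\Psi(u_1,\dots,u_n)$ be the rational function in the variables $u_1,\dots,u_n$ with values in the Hecke algebra $\mathcal H_n$ given by $$\Psi(u_1,\dots,u_n)=\prod_{k=1,\dots,n-1}^{\longrightarrow}\Big(T_k(u_1,u_{k+1})\,T_{k-1}(u_2,u_{k+1})\cdots T_1(u_k,u_{k+1})\Big)\cdot T_{w_n}^{-1},$$ where the factors of the ordered product are written from left to right in the order $k=1,2,\dots,n-1$. Then the primitive idempotent $E_{\mathcal T}$ of $\mathcal H_n$ can be obtained by the consecutive evaluations $$E_{\mathcal T}=f(\lambda)\cdot\Psi(u_1,\dots,u_n)\big|_{u_1=\sigma_1}\big|_{u_2=\sigma_2}\cdots\big|_{u_n=\sigma_n},$$ where the rational functions are regular at the evaluation points at each step.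
   Context: **Hecke algebra.** $q$ is a formal variable. $\mathcal H_n$ is the unital associative algebra over $\mathbb C(q)$ with generators $T_1,\dots,T_{n-1}$ and relations $T_iT_{i+1}T_i=T_{i+1}T_iT_{i+1}$, $T_iT_j=T_jT_i$ for $|i-j|>1$, and $T_i^2=1+(q-q^{-1})T_i$. For $w\in\mathfrak S_n$ with reduced decomposition $w=s_{i_1}\cdots s_{i_l}$, $s_i=(i,i+1)$, put $T_w=T_{i_1}\cdots T_{i_l}$ (independent of the decomposition); the $T_w$ form a basis of $\mathcal H_n$. $w_k$ is the longest element of $\mathfrak S_k\subset\mathfrak S_n$ and $T_{w_k}$ the corresponding element ($T_{w_1}=1$). For $m\leqslant n$, $\mathcal H_m$ is regarded as the subalgebra of $\mathcal H_n$ generated by $T_1,\dots,T_{m-1}$. **Baxterized elements.** For variables $x,y$, $$T_i(x,y)=\frac{T_i\,y-T_i^{-1}x}{y-x}=T_i+\frac{q-q^{-1}}{x^{-1}y-1}.$$ **Jucys–Murphy elements.** $y_1=1$, $y_{k+1}=T_ky_kT_k$ for $k=1,\dots,n-1$; they commute pairwise. **Combinatorics.** A partition is identified with its diagram (left-justified rows, row $i$ having $\lambda_i$ cells). A $\lambda$-tableau is a bijective filling of the cells with $1,\dots,n$; it is standard if entries increase along rows and down columns. The $q$-content of the cell in row $i$, column $j$ is $q^{2(j-i)}$. A cell outside a diagram $\mu$ is addable to $\mu$ if its union with $\mu$ is a diagram. With $\lambda'$ the conjugate partition, the cell $\alpha=(i,j)$ of $\lambda$ has hook length $h_\alpha=\lambda_i+\lambda'_j-i-j+1$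 and content $c_\alpha=j-i$. Also $[m]_q=(q^m-q^{-m})/(q-q^{-1})$. **Idempotents.** The orthogonal primitive idempotents $E_{\mathcal T}\in\mathcal H_n$ are defined inductively: $E_{\mathcal T}=1$ if $n=1$; for $n\geqslant2$, $$E_{\mathcal T}=E_{\mathcal U}\,\frac{(y_n-\rho_1)\cdots(y_n-\rho_r)}{(\sigma-\rho_1)\cdots(\sigma-\rho_r)},$$ where $\mathcal U$ is obtained from $\mathcal T$ by removing the cell $\alpha$ occupied by $n$, $\mu$ is the shape of $\mathcal U$, $\sigma$ is the $q$-content of $\alpha$, and $\rho_1,\dots,\rho_r$ are the $q$-contents of all addable cells of $\mu$ other than $\alpha$. **Evaluations.** An $\mathcal H_n$-valued rational function is an element of $\mathcal H_n\otimes_{\mathbb C(q)}\mathbb C(q)(u_1,\dots,u_n)$. Consecutive evaluation means: set $u_1=\sigma_1$ first, giving a rational function of $u_2,\dots,u_n$; then set $u_2=\sigma_2$ in the result; and so on. Regularity at step $k$ means that the current function of $u_k,\dots,u_n$ has no pole along $u_k=\sigma_k$ (all of its coordinates in the basis $T_w$ can be written with denominators not divisible by $u_k-\sigma_k$). Individual factors need not be regular. *)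

(* Defs.v *)
From HB Require Import structures.
From mathcomp Require Import all_boot all_order all_fingroup all_algebra.
From mathcomp Require Import boolp classical_sets reals.
From mathcomp Require Import fraction complex.
From mathcomp Require Import mpoly generic_quotient.

Set Implicit Arguments.
Unset Strict Implicit.
Unset Printing Implicit Defensive.

Import GRing.Theory.

Local Open Scope ring_scope.
Local Open Scope quotient_scope.

(** * Associative unital algebras given by generators and relations *)

(* Noncommutative polynomial expressions in generators indexed by I. *)
Inductive pterm (K I : Type) : Type :=
| Gen of I
| Scal of K
| Add of pterm K I & pterm K I
| Mul of pterm K I & pterm K I.

Arguments Gen {K I}.
Arguments Scal {K I}.

(* The least congruence that contains rel and makes the quotient an
   associative unital K-algebra in which Scal c is the scalar c. *)
Inductive pcong (K : comNzRingType) (I : Type)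
    (rel : pterm K I -> pterm K I -> Prop) : pterm K I -> pterm K I -> Prop :=
| pcong_rel x y of rel x y : pcong rel x y
| pcong_refl x : pcong rel x x
| pcong_sym x y of pcong rel x y : pcong rel y x
| pcong_trans y x z of pcong rel x y & pcong rel y z : pcong rel x z
| pcong_add x x' y y' of pcong rel x x' & pcong rel y y' :
    pcong rel (Add x y) (Add x' y')
| pcong_mul x x' y y' of pcong rel x x' & pcong rel y y' :
    pcong rel (Mul x y) (Mul x' y')
| pcong_addA x y z : pcong rel (Add x (Add y z)) (Add (Add x y) z)
| pcong_addC x y : pcong rel (Add x y) (Add y x)
| pcong_add0 x : pcong rel (Add (Scal 0) x) x
| pcong_addN x : pcong rel (Add (Mul (Scal (-1)) x) x) (Scal 0)
| pcong_mulA x y z : pcong rel (Mul x (Mul y z)) (Mul (Mul x y) z)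
| pcong_mul1l x : pcong rel (Mul (Scal 1) x) x
| pcong_mul1r x : pcong rel (Mul x (Scal 1)) x
| pcong_mulDl x y z : pcong rel (Mul (Add x y) z) (Add (Mul x z) (Mul y z))
| pcong_mulDr x y z : pcong rel (Mul x (Add y z)) (Add (Mul x y) (Mul x z))
| pcong_scalC c x : pcong rel (Mul (Scal c) x) (Mul x (Scal c))
| pcong_scalD c d : pcong rel (Scal (c + d)) (Add (Scal c) (Scal d))
| pcong_scalM c d : pcong rel (Scal (c * d)) (Mul (Scal c) (Scal d)).

HB.instance Definition _ (K I : Type) := gen_eqMixin (pterm K I).
HB.instance Definition _ (K I : Type) := gen_choiceMixin (pterm K I).

Section Presented.
Variables (K : comNzRingType) (I : Type).
Variable rel : pterm K I -> pterm K I -> Prop.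

Definition pcongb (x y : pterm K I) : bool := `[< pcong rel x y >].

Lemma pcongb_equiv : equiv_class_of pcongb.
Proof.
split=> [x | x y | y x z]; first exact/asboolP/pcong_refl.
  by apply/idP/idP => /asboolP xy; apply/asboolP/pcong_sym.
by move=> /asboolP xy /asboolP yz; apply/asboolP/(pcong_trans xy yz).
Qed.

Canonical pcongb_equiv_rel := EquivRelPack pcongb_equiv.

Definition presented : Type := {eq_quot pcongb}.

HB.instance Definition _ := Choice.on presented.
HB.instance Definition _ := EqQuotient.on presented.

Lemma pres_eq x y : pcong rel x y -> \pi_presented x = \pi_presented y.
Proof. by move=> xy; apply/(@eqquotP _ pcongb)/asboolP. Qed.

Lemma pres_repr x : pcong rel (repr (\pi_presented x)) x.
Proof. by apply/asboolP/(@eqquotP _ pcongb presented); rewrite reprK. Qed.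

Definition pgen (i : I) : presented := \pi_presented (Gen i).
Definition pscal (c : K) : presented := \pi_presented (Scal c).
Definition padd (x y : presented) : presented := \pi_presented (Add (repr x) (repr y)).
Definition pmul (x y : presented) : presented := \pi_presented (Mul (repr x) (repr y)).
Definition popp (x : presented) : presented := pmul (pscal (-1)) x.
Definition pscale (c : K) (x : presented) : presented := pmul (pscal c) x.

Lemma padd_pi x y : padd (\pi_presented x) (\pi_presented y) = \pi_presented (Add x y).
Proof. by apply: pres_eq; apply: pcong_add; apply: pres_repr. Qed.

Lemma pmul_pi x y : pmul (\pi_presented x) (\pi_presented y) = \pi_presented (Mul x y).
Proof. by apply: pres_eq; apply: pcong_mul; apply: pres_repr. Qed.

Lemma paddA : associative padd.
Proof.
elim/quotW=> x; elim/quotW=> y; elim/quotW=> z.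
by rewrite (padd_pi y) !(padd_pi x) padd_pi; apply: pres_eq; apply: pcong_addA.
Qed.

Lemma paddC : commutative padd.
Proof.
by elim/quotW=> x; elim/quotW=> y; rewrite !padd_pi; apply: pres_eq; apply: pcong_addC.
Qed.

Lemma padd0 : left_id (pscal 0) padd.
Proof. by elim/quotW=> x; rewrite padd_pi; apply: pres_eq; apply: pcong_add0. Qed.

Lemma paddN : left_inverse (pscal 0) popp padd.
Proof.
by elim/quotW=> x; rewrite /popp pmul_pi padd_pi; apply: pres_eq; apply: pcong_addN.
Qed.

HB.instance Definition _ :=
  GRing.isZmodule.Build presented paddA paddC padd0 paddN.

Lemma pmulA : associative pmul.
Proof.
elim/quotW=> x; elim/quotW=> y; elim/quotW=> z.
by rewrite (pmul_pi y) !(pmul_pi x) pmul_pi; apply: pres_eq; apply: pcong_mulA.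
Qed.

Lemma pmul1l : left_id (pscal 1) pmul.
Proof. by elim/quotW=> x; rewrite pmul_pi; apply: pres_eq; apply: pcong_mul1l. Qed.

Lemma pmul1r : right_id (pscal 1) pmul.
Proof. by elim/quotW=> x; rewrite pmul_pi; apply: pres_eq; apply: pcong_mul1r. Qed.

Lemma pmulDl : left_distributive pmul padd.
Proof.
elim/quotW=> x; elim/quotW=> y; elim/quotW=> z.
by rewrite (padd_pi x) !pmul_pi padd_pi; apply: pres_eq; apply: pcong_mulDl.
Qed.

Lemma pmulDr : right_distributive pmul padd.
Proof.
elim/quotW=> x; elim/quotW=> y; elim/quotW=> z.
by rewrite (padd_pi y) !pmul_pi padd_pi; apply: pres_eq; apply: pcong_mulDr.
Qed.

HB.instance Definition _ :=
  GRing.Zmodule_isPzRing.Build presented pmulA pmul1l pmul1r pmulDl pmulDr.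

Lemma pscaleA c d x : pscale c (pscale d x) = pscale (c * d) x.
Proof.
rewrite /pscale pmulA; congr pmul.
by rewrite pmul_pi; apply: pres_eq; apply: pcong_sym; apply: pcong_scalM.
Qed.

Lemma pscaleDl x : {morph pscale^~ x : c d / c + d}.
Proof.
move=> c d; rewrite /pscale -[RHS]pmulDl; congr pmul.
by rewrite padd_pi; apply: pres_eq; apply: pcong_scalD.
Qed.

HB.instance Definition _ :=
  GRing.Zmodule_isLmodule.Build K presented
    pscaleA pmul1l (fun c => pmulDr (pscal c)) pscaleDl.

Lemma pscaleAl c (x y : presented) : c *: (x * y) = (c *: x) * y.
Proof. exact: pmulA. Qed.

Lemma pscaleAr c (x y : presented) : c *: (x * y) = x * (c *: y).
Proof.
suff cx : pmul (pscal c) x = pmul x (pscal c).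
  by rewrite pscaleAl /GRing.scale /= /pscale cx; apply/esym/pmulA.
by elim/quotW: x => x; rewrite !pmul_pi; apply: pres_eq; apply: pcong_scalC.
Qed.

(* Universal property: images of the generators in an algebra A that satisfy
   the relations extend uniquely to an algebra morphism. *)

Fixpoint pinterp (A : algType K) (g : I -> A) (x : pterm K I) : A :=
  match x with
  | Gen i => g i
  | Scal c => c%:A
  | Add x y => pinterp g x + pinterp g y
  | Mul x y => pinterp g x * pinterp g y
  end.

Lemma pinterp_cong (A : algType K) (g : I -> A) :
  (forall x y, rel x y -> pinterp g x = pinterp g y) ->
  forall x y, pcong rel x y -> pinterp g x = pinterp g y.
Proof.
move=> grel x y; elim=> {x y} /=.
- exact: grel.
- by [].
- by move=> x y _ ->.
- by move=> x y z _ -> _ ->.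
- by move=> x x' y y' _ -> _ ->.
- by move=> x x' y y' _ -> _ ->.
- by move=> x y z; rewrite addrA.
- by move=> x y; rewrite addrC.
- by move=> x; rewrite scale0r add0r.
- by move=> x; rewrite scaleN1r mulN1r addNr scale0r.
- by move=> x y z; rewrite mulrA.
- by move=> x; rewrite scale1r mul1r.
- by move=> x; rewrite scale1r mulr1.
- by move=> x y z; rewrite mulrDl.
- by move=> x y z; rewrite mulrDr.
- by move=> c x; rewrite mulr_algl mulr_algr.
- by move=> c d; rewrite scalerDl.
- by move=> c d; rewrite mulr_algl scalerA.
Qed.

Definition plift (A : algType K) (g : I -> A) (x : presented) : A :=
  pinterp g (repr x).

Lemma plift_spec (A : algType K) (g : I -> A) :
    (forall x y, rel x y -> pinterp g x = pinterp g y) ->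
  [/\ forall i, plift g (pgen i) = g i,
      plift g 1 = 1,
      {morph plift g : x y / x + y},
      {morph plift g : x y / x * y}
    & forall c, {morph plift g : x / c *: x}].
Proof.
move=> /pinterp_cong grel.
have liftE x : plift g (\pi_presented x) = pinterp g x by apply/grel/pres_repr.
split=> [i||x y|x y|c x].
- exact: liftE.
- by apply: etrans (liftE (Scal 1)) _; rewrite /= scale1r.
- exact: etrans (liftE (Add _ _)) _.
- exact: etrans (liftE (Mul _ _)) _.
apply: etrans (liftE (Mul _ _)) _ => /=.
by rewrite (grel _ _ (pres_repr (Scal c))) /= mulr_algl.
Qed.

End Presented.

Arguments pgen {K I} rel i.

(** * The Hecke algebra *)

(* The indices i = 1, ..., n-1 of the generators. *)
Definition gidx (n : nat) : Type := {i : nat | 0 < i < n}%N.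
HB.instance Definition _ n := SubType.on (gidx n).
HB.instance Definition _ n := Choice.on (gidx n).

Section Hecke.
Variables (K : fieldType) (q : K) (n : nat).
Implicit Types i j : gidx n.

Inductive hecke_rel : pterm K (gidx n) -> pterm K (gidx n) -> Prop :=
| hecke_braid i j of val j = (val i).+1 :
    hecke_rel (Mul (Gen i) (Mul (Gen j) (Gen i)))
              (Mul (Gen j) (Mul (Gen i) (Gen j)))
| hecke_comm i j of ((val i).+1 < val j)%N || ((val j).+1 < val i)%N :
    hecke_rel (Mul (Gen i) (Gen j)) (Mul (Gen j) (Gen i))
| hecke_quad i :
    hecke_rel (Mul (Gen i) (Gen i))
              (Add (Scal 1) (Mul (Scal (q - q^-1)) (Gen i))).

Definition hecke : Type := presented hecke_rel.

HB.instance Definition _ := Choice.on hecke.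
HB.instance Definition _ := GRing.PzRing.on hecke.
HB.instance Definition _ := GRing.Lmodule.on hecke.

(* Proved with the one-dimensional representation sending every generator to q
   (to 1 in the degenerate case q = 0). *)
Lemma hecke_nontrivial : (1 : hecke) != 0.
Proof.
pose g (_ : gidx n) : K^o := if q == 0 then 1 else q.
have grel x y : hecke_rel x y -> pinterp g x = pinterp g y.
  case=> [i j _|i j _|i] //=; rewrite /g; case: eqP => [->|/eqP q0].
    by rewrite invr0 subrr scale0r mul0r addr0 scale1r mulr1.
  rewrite scale1r mulr_algl [X in _ = _ + X]mulrBl -[X in _ = X + _]mulr1.
  by rewrite mulVf // addrC mulr1 subrK.
have [_ l1 _ _ lZ] := plift_spec grel.
apply/eqP => e; have := oner_neq0 K; rewrite -[1]/(1 : K^o) -l1 e.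
by rewrite -(scale0r (0 : hecke)) lZ scale0r eqxx.
Qed.

HB.instance Definition _ :=
  GRing.PzSemiRing_isNonZero.Build hecke hecke_nontrivial.
HB.instance Definition _ :=
  GRing.Lmodule_isLalgebra.Build K hecke (@pscaleAl _ _ hecke_rel).
HB.instance Definition _ :=
  GRing.Lalgebra_isAlgebra.Build K hecke (@pscaleAr _ _ hecke_rel).

Definition hecke_is_inv (x y : hecke) : Prop := y * x = 1 /\ x * y = 1.
Definition hecke_unit (x : hecke) : bool := `[< exists y, hecke_is_inv x y >].
Definition hecke_inv (x : hecke) : hecke := xget x [set y | hecke_is_inv x y].

Lemma hecke_invP x : hecke_unit x -> hecke_is_inv x (hecke_inv x).
Proof. by move=> /asboolP [y xy]; rewrite /hecke_inv; case: xgetP => [z _|/(_ y)]. Qed.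

Lemma hecke_mulVr : {in hecke_unit, left_inverse 1 hecke_inv *%R}.
Proof. by move=> x /hecke_invP []. Qed.

Lemma hecke_mulrV : {in hecke_unit, right_inverse 1 hecke_inv *%R}.
Proof. by move=> x /hecke_invP []. Qed.

Lemma hecke_unitP x y : y * x = 1 /\ x * y = 1 -> hecke_unit x.
Proof. by move=> xy; apply/asboolP; exists y. Qed.

Lemma hecke_inv_out : {in [predC hecke_unit], hecke_inv =1 id}.
Proof.
move=> x /negP nx; rewrite /hecke_inv; case: xgetP => // y _ xy.
by case: nx; apply/asboolP; exists y.
Qed.

HB.instance Definition _ :=
  GRing.NzRing_hasMulInverse.Build hecke
    hecke_mulVr hecke_mulrV hecke_unitP hecke_inv_out.

(* T_i for 1 <= i <= n-1, and the dummy value 0 for other i. *)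
Definition hT (i : nat) : hecke :=
  if insub i is Some j then pgen hecke_rel j else 0.

(* The transposition s_i = (i, i+1); 'I_n is 0-based. *)
Definition stransp i : 'S_n :=
  let lt_in : (val i < n)%N := proj2 (andP (valP i)) in
  tperm (Ordinal (leq_ltn_trans (leq_pred _) lt_in)) (Ordinal lt_in).

Definition sprod (r : seq (gidx n)) : 'S_n := (\prod_(i <- r) stransp i)%g.

Definition reduced_word (w : 'S_n) (r : seq (gidx n)) : Prop :=
  sprod r = w /\ forall r', sprod r' = w -> (size r <= size r')%N.

Definition reduced (w : 'S_n) : seq (gidx n) := xget [::] (reduced_word w).

Definition perm_length (w : 'S_n) : nat := size (reduced w).

Definition hTw (w : 'S_n) : hecke := \prod_(i <- reduced w) pgen hecke_rel i.

Definition wlongest : 'S_n := [arg max_(w > 1%g) perm_length w].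

(* Jucys-Murphy elements y_1 = 1, y_{k+1} = T_k y_k T_k. *)
Fixpoint jm (k : nat) : hecke :=
  match k with
  | 0 | 1 => 1
  | (k'.+1 as k1).+1 => hT k1 * jm k1 * hT k1
  end.

End Hecke.

(** * Partitions and tableaux *)

(* Cells are pairs (i, j) = (row, column), numbered from 1. *)
Definition cell : Type := (nat * nat)%type.

Definition is_partition (lam : seq nat) : bool :=
  sorted geq lam && (0 \notin lam).

Definition part (lam : seq nat) (i : nat) : nat := nth 0 lam i.-1.

Definition conj_part (lam : seq nat) (j : nat) : nat :=
  count (fun r => j <= r)%N lam.

Definition diagram (lam : seq nat) : seq cell :=
  [seq (i, j) | i <- iota 1 (size lam), j <- iota 1 (part lam i)].

Definition is_diagram (D : seq cell) : bool :=
  `[< exists2 nu, is_partition nu & D =i diagram nu >].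

Definition addable (D : seq cell) (c : cell) : bool :=
  (c \notin D) && is_diagram (c :: D).

(* The coordinates of an addable cell are at most #|D| + 1. *)
Definition addable_cells (D : seq cell) : seq cell :=
  let N := (size D).+1 in
  [seq c <- [seq (i, j) | i <- iota 1 N, j <- iota 1 N] | addable D c].

(* Only the values of t on the cells of the diagram matter. *)
Definition is_tableau (lam : seq nat) (t : cell -> nat) : Prop :=
  perm_eq [seq t c | c <- diagram lam] (iota 1 (sumn lam)).

Definition is_standard (lam : seq nat) (t : cell -> nat) : Prop :=
  [/\ is_tableau lam t,
      forall i j j', (i, j) \in diagram lam -> (i, j') \in diagram lam ->
        (j < j')%N -> (t (i, j) < t (i, j'))%N
    & forall i i' j, (i, j) \in diagram lam -> (i', j) \in diagram lam ->
        (i < i')%N -> (t (i, j) < t (i', j))%N].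

(* The cell of D occupied by k in t. *)
Definition cell_of (D : seq cell) (t : cell -> nat) (k : nat) : cell :=
  nth (0, 0)%N D (index k [seq t c | c <- D]).

Definition content (c : cell) : int := c.2%:Z - c.1%:Z.

Definition hook (lam : seq nat) (c : cell) : nat :=
  (part lam c.1 + conj_part lam c.2 + 1 - (c.1 + c.2))%N.

Section Idempotent.
Variables (K : fieldType) (q : K) (n : nat).

Definition qcontent (c : cell) : K := q ^ (2 * content c).

Definition qint (m : nat) : K := (q ^+ m - q ^- m) / (q - q^-1).

Definition fcoef (lam : seq nat) : K :=
  \prod_(c <- diagram lam) (q ^ content c / qint (hook lam c)).

(* The element of H_m, seen in H_n, attached to the standard filling t of the
   diagram D with m cells. *)
Fixpoint idem (m : nat) (D : seq cell) (t : cell -> nat) : hecke q n :=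
  match m with
  | 0 | 1 => 1
  | (m'.+1 as m1).+1 =>
      let alpha := cell_of D t m in
      let mu := rem alpha D in
      let rho := [seq qcontent c | c <- addable_cells mu & c != alpha] in
      idem m1 mu t *
        ((\prod_(r <- rho) (qcontent alpha - r))^-1 *:
         \prod_(r <- rho) (jm q n m - r%:A))
  end.

End Idempotent.

(** * Extension of scalars *)

Section ExtScal.
Variables (K F : fieldType) (iota : {rmorphism K -> F}) (A : algType K).

(* A (x)_K F as the F-algebra generated by the a (x) 1. *)
Inductive tens_rel : pterm F A -> pterm F A -> Prop :=
| tens_add a b : tens_rel (Gen (a + b)) (Add (Gen a) (Gen b))
| tens_mul a b : tens_rel (Gen (a * b)) (Mul (Gen a) (Gen b))
| tens_scal c a : tens_rel (Gen (c *: a)) (Mul (Scal (iota c)) (Gen a))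
| tens_one : tens_rel (Gen 1) (Scal 1).

Definition extscal : Type := presented tens_rel.

HB.instance Definition _ := Choice.on extscal.
HB.instance Definition _ := GRing.PzRing.on extscal.
HB.instance Definition _ := GRing.Lmodule.on extscal.

(* a (x) 1 *)
Definition tens1 (a : A) : extscal := pgen tens_rel a.

End ExtScal.

(** * Rational functions with values in the Hecke algebra *)

Section RationalFunctions.
Variables (K : fieldType) (q : K) (n : nat).

(* K(u_1, ..., u_n); the variable u_{k+1} is 'X_k for k : 'I_n. *)
Definition ratfun : fieldType := {fraction {mpoly K[n]}}.

Definition ratconst : {rmorphism K -> ratfun} :=
  (@tofrac {mpoly K[n]}) \o (@mpolyC n K).

Definition hfun : Type := extscal ratconst (hecke q n).

HB.instance Definition _ := Choice.on hfun.
HB.instance Definition _ := GRing.PzRing.on hfun.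
HB.instance Definition _ := GRing.Lmodule.on hfun.

(* u_k for 1 <= k <= n, and the dummy value 0 for k > n. *)
Definition uvar (k : nat) : ratfun :=
  if insub k.-1 is Some i then @tofrac {mpoly K[n]} 'X_i else 0.

(* T_i(x, y) *)
Definition baxter (i : nat) (x y : ratfun) : hfun :=
  (y - x)^-1 *: (y *: tens1 ratconst (hT q n i) - x *: tens1 ratconst (hT q n i)^-1).

Definition Psi : hfun :=
  (\prod_(1 <= k < n)
     \prod_(1 <= j < k.+1) baxter (k.+1 - j) (uvar j) (uvar k.+1))
  * tens1 ratconst (hTw q (wlongest n))^-1.

(* The polynomial p with u_{k+1} := s; its coefficients no longer involve
   u_{k+1}, so that K(u_{k+2}, ..., u_n) is regarded as a subfield of ratfun. *)
Definition psubst (k : 'I_n) (s : K) (p : {mpoly K[n]}) : {mpoly K[n]} :=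
  p \mPo [tuple (if i == k then s%:MP else 'X_i) | i < n].

(* The rational function a has no pole along u_{k+1} = s, and its restriction
   to u_{k+1} = s is b. *)
Definition rat_eval (k : 'I_n) (s : K) (a b : ratfun) : Prop :=
  exists p d : {mpoly K[n]},
    [/\ ~ (exists e, d = e * ('X_k - s%:MP)),
        a = @tofrac {mpoly K[n]} p / @tofrac {mpoly K[n]} d
      & b = @tofrac {mpoly K[n]} (psubst k s p) /
            @tofrac {mpoly K[n]} (psubst k s d)].

(* Same for a function with values in the Hecke algebra, by means of its
   coordinates in the basis of the T_w. *)
Definition hfun_eval (k : 'I_n) (s : K) (f g : hfun) : Prop :=
  exists a b : 'S_n -> ratfun,
    [/\ f = \sum_w a w *: tens1 ratconst (hTw q w),
        g = \sum_w b w *: tens1 ratconst (hTw q w)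
      & forall w, rat_eval k s (a w) (b w)].

End RationalFunctions.

(** * The ground field *)

(* C(q); R : realType is a model of the real numbers, and R[i] of C. *)
Definition Cq (R : realType) : fieldType := {fraction {poly (complex R)}}.

Definition qvar (R : realType) : Cq R := @tofrac {poly (complex R)} 'X.

(* Main.v *)
(* Let E_m be the idempotent of the first m cells.  It is a right eigenvector of the
   Jucys-Murphy elements y_1, ..., y_m with eigenvalues the contents, and y_{m+1}
   satisfies on it the polynomial whose roots are the contents of the addable cells:
   this is shown for every weight vector by induction on the tableau, with the
   intertwiners that transpose two successive weights (Okounkov-Vershik).
   If w has weights s_1, ..., s_m for y_1, ..., y_m and r for y_{m+1}, then
     (u - r) w T_m^-1 ... T_1^-1 T_1(s_1, u) ... T_m(s_m, u) =
       (u - 1) prod_k (u - q^2 s_k) (u - q^-2 s_k) / (u - s_k)^2 w.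
   Since T_{w_m} T_m(s_1, u) ... T_1(s_m, u) is the same product of the T_k^-1 and
   T_k(s_k, u) followed by T_{w_{m+1}}, splitting E_m into eigenvectors of y_{m+1}
   gives the evaluation of a block: only the component E_{m+1} survives at
   u = s_{m+1}, and the telescoping of the scalar over columns and rows gives the
   quotient f(mu) / f(lambda) of hook products.  Coordinates with respect to the T_w
   are never computed: it suffices that the T_w span. *)
Require Import Defs.
From HB Require Import structures.
From mathcomp Require Import all_boot all_order all_fingroup all_algebra.
From mathcomp Require Import reals.
From mathcomp Require Import boolp.
From mathcomp Require Import fraction complex mpoly.
From mathcomp Require Import ring zify.

Set Implicit Arguments.
Unset Strict Implicit.
Unset Printing Implicit Defensive.

Import GRing.Theory.
Local Open Scope ring_scope.

(** * Families of elements satisfying the Hecke relations *)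

(** The obstacle is that a factor T_i(s_j, u_(m+1)) of the block evaluated at step m+1 has a pole
    whenever s_j = s_(m+1), so a block cannot be evaluated factor by factor. The remedy is the
    product E_m T_(w_m) standing on its left: carrying T_(w_m) through the block reverses the
    indices of the factors, and on an eigenvector of y_(m+1) with eigenvalue r the block then acts
    by a scalar function of u. That function has a zero at the content of the new cell, and the
    division by u - r cancels this zero for exactly one r. The later blocks are harmless, since each
    contains a variable that is not yet specialised. All facts on eigenvalues come from right
    multiplication inside the algebra; no representation of it is constructed for them. The
    relations are studied for any family T in any algebra because they are needed twice: for the
    generators of H_n, and for their images over the field of rational functions. *)

Definition hecke_gens (F : fieldType) (q : F) (B : algType F) (N : nat)
    (T : nat -> B) : Prop :=
  [/\ forall i, (0 < i)%N -> (i.+1 < N)%N ->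
        T i * T i.+1 * T i = T i.+1 * T i * T i.+1,
      forall i j, (0 < i)%N -> (i.+1 < j)%N -> (j < N)%N -> T i * T j = T j * T i
    & forall i, (0 < i < N)%N -> T i * T i = 1 + (q - q^-1) *: T i].

Section HeckeGens.
Variables (F : fieldType) (q : F) (B : algType F) (N : nat) (T : nat -> B).
Hypothesis TH : hecke_gens q N T.

(** By the quadratic relation this is T_i^-1, given as a polynomial so that [B] need not carry a
    unit structure. *)
Definition gV (i : nat) : B := T i - (q - q^-1)%:A.

Fixpoint gjm (k : nat) : B :=
  match k with
  | 0 | 1 => 1
  | (k'.+1 as k1).+1 => T k1 * gjm k1 * T k1
  end.

(** [gupV k] is the inverse of [gup k], the product T_1 ... T_k. [glong k] follows the reduced word
    (1)(2 1)(3 2 1)... of the longest element of S_k. *)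
Fixpoint gdown (k : nat) : B := if k is k'.+1 then T k * gdown k' else 1.
Fixpoint gup (k : nat) : B := if k is k'.+1 then gup k' * T k else 1.
Fixpoint gupV (k : nat) : B := if k is k'.+1 then gV k * gupV k' else 1.
Fixpoint glong (k : nat) : B := if k is k'.+1 then glong k' * gdown k' else 1.

Definition gbaxter (i : nat) (x y : F) : B :=
  (y - x)^-1 *: (y *: T i - x *: gV i).

Let braid i : (0 < i)%N -> (i.+1 < N)%N ->
  T i * T i.+1 * T i = T i.+1 * T i * T i.+1.
Proof. by case: TH => + _ _; apply. Qed.

Lemma gcomm i j : (0 < i < N)%N -> (0 < j < N)%N -> (i.+1 < j)%N || (j.+1 < i)%N ->
  T i * T j = T j * T i.
Proof.
by case: TH => _ cT _ /andP[i0 iN] /andP[j0 jN] /orP[ij|ji]; [|symmetry]; apply: cT.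
Qed.

Lemma gquad i : (0 < i < N)%N -> T i * T i = 1 + (q - q^-1) *: T i.
Proof. by case: TH => _ _; apply. Qed.

Lemma gmulV i : (0 < i < N)%N -> T i * gV i = 1.
Proof. by move=> iN; rewrite mulrBr gquad // mulr_algr addrK. Qed.

Lemma gVmul i : (0 < i < N)%N -> gV i * T i = 1.
Proof. by move=> iN; rewrite mulrBl gquad // mulr_algl addrK. Qed.

Lemma gjmS k : (0 < k)%N -> gjm k.+1 = T k * gjm k * T k.
Proof. by case: k. Qed.

Lemma gjm_word (x : B) k : (k <= N)%N ->
  (forall i, (0 < i < k)%N -> x * T i = T i * x) -> x * gjm k = gjm k * x.
Proof.
elim: k => [|[|k] IH] kN cx; rewrite ?mulr1 ?mul1r //= -/(gjm k.+1).
rewrite !mulrA cx ?ltnS ?leqnn // -(mulrA _ x) IH ?(ltnW kN) // => [|i /andP[i0 ik]].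
  by rewrite -!mulrA cx // ltnS leqnn.
by apply: cx; rewrite i0 ltnW.
Qed.

Lemma gcomm_jm i k : (0 < i < N)%N -> (0 < k <= N)%N -> i != k -> i.+1 != k ->
  T i * gjm k = gjm k * T i.
Proof.
elim: k => // k IH iN /andP[_ kN] ik; rewrite eqSS => ik1.
case: (ltnP k i) => [ki | ].
  by apply: gjm_word => // j /andP[j0 jk]; apply: gcomm; lia.
rewrite leq_eqVlt (negbTE ik1) orFb => {}ik; rewrite gjmS; last by lia.
case: (eqVneq i.+1 k) => [ek | ne]; last first.
  have cTk : T i * T k = T k * T i by apply: gcomm; lia.
  rewrite !mulrA cTk -(mulrA _ (T i)) IH //; try lia.
  by rewrite -!mulrA cTk.
(* Here y_(i+2) = T_(i+1) T_i y_i T_i T_(i+1): the braid relation on the left turns the incoming T_i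
   into T_(i+1), which crosses y_i, and the braid relation on the right turns it back. *)
subst k; rewrite gjmS; last by lia.
have cj : T i.+1 * gjm i = gjm i * T i.+1.
  by apply: gjm_word; [lia | move=> j ?; apply: gcomm; lia].
rewrite !mulrA braid; try lia.
rewrite -[T i.+1 * T i * T i.+1 * _]mulrA cj -!mulrA; do 3 congr (_ * _).
by rewrite !mulrA braid; try lia.
Qed.

Lemma gjmC k l : (0 < k <= N)%N -> (0 < l <= N)%N -> gjm k * gjm l = gjm l * gjm k.
Proof.
wlog kl : k l / (k < l)%N.
  move=> H kN lN; case: (ltngtP k l) => [kl|lk|-> //]; first exact: H.
  by symmetry; apply: H.
move=> kN lN; symmetry; apply: gjm_word; first by lia.
by move=> i ik; symmetry; apply: gcomm_jm; lia.
Qed.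

Lemma gupV_gup k : (k < N)%N -> gupV k * gup k = 1.
Proof.
elim: k => [|k IH] kN; first by rewrite mulr1.
rewrite /= mulrA -(mulrA (gV k.+1)) IH; last by lia.
by rewrite mulr1 gVmul // ltnS.
Qed.

Lemma gdown_word (x : B) k :
  (forall i, (0 < i <= k)%N -> x * T i = T i * x) -> x * gdown k = gdown k * x.
Proof.
elim: k => [|k IH] cx; first by rewrite mulr1 mul1r.
rewrite /= mulrA cx ?leqnn // -mulrA IH ?mulrA // => i ik.
by apply: cx; lia.
Qed.

Lemma gup_word (x : B) k :
  (forall i, (0 < i <= k)%N -> x * T i = T i * x) -> x * gup k = gup k * x.
Proof.
elim: k => [|k IH] cx; first by rewrite mulr1 mul1r.
rewrite /= mulrA IH; last by move=> i ik; apply: cx; lia.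
by rewrite -mulrA cx ?leqnn // mulrA.
Qed.

Lemma glongSr k : glong k.+1 = glong k * gdown k. Proof. by []. Qed.

Lemma glong_word (x : B) k :
  (forall i, (0 < i < k)%N -> x * T i = T i * x) -> x * glong k = glong k * x.
Proof.
elim: k => [|k IH] cx; first by rewrite mulr1 mul1r.
rewrite /= mulrA IH; last by move=> i ik; apply: cx; lia.
by rewrite -mulrA gdown_word ?mulrA // => i ik; apply: cx; lia.
Qed.

Lemma glongS k : (k < N)%N -> glong k.+1 = gup k * glong k.
Proof.
elim: k => [|k IH] kN //=.
rewrite -[LHS]/(glong k.+1 * (T k.+1 * gdown k)) IH; last by lia.
rewrite -!mulrA; congr (_ * _); rewrite !mulrA; congr (_ * _).
by symmetry; apply: glong_word => i ik; apply: gcomm; lia.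
Qed.

Lemma gup_shift k i : (0 < i < k)%N -> (k < N)%N -> gup k * T i = T i.+1 * gup k.
Proof.
elim: k => [|k IH] ik kN /=; first by lia.
case: (eqVneq i k) => [ek | ne].
  subst k; case: i IH ik kN => // i IH ik kN /=.
  rewrite -!mulrA (mulrA (T i.+1)) braid // !mulrA; congr (_ * _ * _).
  by symmetry; apply: gup_word => j ji; apply: gcomm; lia.
rewrite -mulrA (@gcomm k.+1); try lia.
by rewrite mulrA IH ?mulrA //; lia.
Qed.

Lemma gdown_shift k i : (0 < i < k)%N -> (k < N)%N -> gdown k * T i.+1 = T i * gdown k.
Proof.
elim: k => [|k IH] ik kN /=; first by lia.
case: (eqVneq i k) => [ek | ne].
  subst k; case: i IH ik kN => // i IH ik kN /=.
  have c : gdown i * T i.+2 = T i.+2 * gdown i.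
    by symmetry; apply: gdown_word => j ji; apply: gcomm; lia.
  by rewrite -!mulrA c !mulrA -braid.
rewrite -mulrA IH; try lia.
by rewrite !mulrA (@gcomm k.+1); try lia.
Qed.

(** Conjugation by the longest element reverses the Dynkin diagram. Both factorisations of [glong]
    are needed: [glongS] lets the index drop for j below the top, [glongSr] treats the top
    generator. *)
Lemma glong_shift k j : (0 < j < k)%N -> (k <= N)%N -> glong k * T j = T (k - j) * glong k.
Proof.
elim: k j => [|k IH] j jk kN; first by lia.
case: (ltnP j k) => [jk1 | kj].
  rewrite glongS; last by lia.
  rewrite -mulrA IH; try lia.
  by rewrite !mulrA gup_shift ?subSn //; lia.
have ej : j = k by lia.
subst j; rewrite subSnn.
case: k IH jk kN {kj} => [|[|k]] IH jk kN; first by lia.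
  by rewrite /= !mul1r mulr1.
rewrite (glongSr k.+2) -mulrA gdown_shift; try lia.
by rewrite mulrA IH ?subSnn ?mulrA //; lia.
Qed.

Lemma gbaxterE i x y : y != x ->
  gbaxter i x y = T i + ((q - q^-1) * x / (y - x))%:A.
Proof.
move=> yx; have d0 : y - x != 0 by rewrite subr_eq0.
rewrite /gbaxter; have -> : y *: T i - x *: gV i = (y - x) *: T i + ((q - q^-1) * x)%:A.
  by rewrite scalerBr scalerA opprB scalerBl mulrC addrA addrAC.
by rewrite scalerDr !scalerA mulVf // scale1r mulrC.
Qed.

(** Unitarity of the Baxterized elements: the scalar parts a, b of the two factors satisfy a + b =
    -(q - q^-1), which cancels the coefficient of T_i produced by the quadratic relation. *)
Lemma gbaxter_mul i x y : (0 < i < N)%N -> q != 0 -> x != y ->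
  gbaxter i x y * gbaxter i y x =
  ((x - q ^+ 2 * y) * (x - q ^- 2 * y) / (x - y) ^+ 2)%:A.
Proof.
move=> iN q0 xy; have yx : y != x by rewrite eq_sym.
have d0 : x - y != 0 by rewrite subr_eq0.
have e0 : y - x != 0 by rewrite subr_eq0.
rewrite !gbaxterE //; set a := _ / (y - x); set b := _ / (x - y); set k := q - q^-1.
have kab : k + a + b = 0 by rewrite /k /a /b; field; rewrite d0 e0 q0.
rewrite mulrDl !mulrDr !mulr_algl mulr_algr gquad // scalerA.
rewrite [LHS](AC (3 * 2) ((2 * 4 * 3) * (1 * 5))) /= -!scalerDl kab.
rewrite scale0r add0r -[X in X + _]scale1r -scalerDl; congr (_ *: _).
by rewrite /a /b /k; field; rewrite d0 e0 q0.
Qed.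

Definition gwt (w : B) (m : nat) (s : nat -> F) : Prop :=
  forall k, (0 < k <= m)%N -> w * gjm k = s k *: w.

(** [gY] is a block as it stands in [Psi]; [gZ] is the same block after conjugation with T_(w_(m+1))
    has reversed its indices. *)
Fixpoint gZ (s : nat -> F) (u : F) (m : nat) : B :=
  if m is m'.+1 then gZ s u m' * gbaxter m (s m) u else 1.

Definition gY (s : nat -> F) (u : F) (m : nat) : B :=
  \prod_(1 <= j < m.+1) gbaxter (m.+1 - j) (s j) u.

Definition gc (s : nat -> F) (u : F) (m : nat) : F :=
  \prod_(1 <= k < m.+1)
    ((u - q ^+ 2 * s k) * (u - q ^- 2 * s k) / (u - s k) ^+ 2).

(** Since y_(m+2) T_(m+1)^-1 = T_(m+1) y_(m+1), the left side is w (u T_(m+1)^-1 - T_(m+1) y_(m+1)).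
    The scalar part of T_(m+1)(u, s_(m+1)) is exactly what the difference between T_(m+1)^-1 and
    T_(m+1) requires once w y_(m+1) is replaced by s_(m+1) w. *)
Lemma gwt_step w m s u : (m.+1 < N)%N -> u != s m.+1 -> gwt w m.+1 s ->
  gwt (w * gbaxter m.+1 u (s m.+1)) m s /\
  w * (u%:A - gjm m.+2) * gV m.+1 =
  w * gbaxter m.+1 u (s m.+1) * (u%:A - gjm m.+1).
Proof.
move=> mN us ws; set a := s m.+1.
have d0 : a - u != 0 by rewrite subr_eq0 eq_sym.
split=> [k /andP[k0 km] | ].
  have cT : T m.+1 * gjm k = gjm k * T m.+1 by apply: gcomm_jm; lia.
  have cb : gbaxter m.+1 u a * gjm k = gjm k * gbaxter m.+1 u a.
    by rewrite gbaxterE 1?eq_sym // mulrDl mulrDr cT mulr_algl mulr_algr.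
  by rewrite -mulrA cb mulrA ws ?scalerAl //; lia.
have wa : w * gjm m.+1 = a *: w by apply: ws; lia.
rewrite gbaxterE 1?eq_sym // (gjmS (ltn0Sn m)); set c := _ / _.
rewrite -mulrA mulrBl -!mulrA gmulV ?ltnS // mulr1 mulr_algl mulrBr.
rewrite [X in _ = w * X]mulrBr mulr_algr [X in _ = w * (_ - X)]mulrDl mulr_algl.
rewrite [RHS]mulrBr -!scalerAr mulrBr !mulrDr !mulr_algr -scalerAr wa scalerBr scalerDr.
rewrite opprD !scalerA -!addrA; congr (_ + _).
rewrite addrCA [LHS]addrC; congr (_ + _).
rewrite -!scaleNr -scalerDl; congr (_ *: _); by rewrite /c; move: (q - q^-1) => k0; field.
Qed.

(** The factor u - y_(m+1) is kept as an operator: the induction passes to w T_m(u, s_m), which need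
    not be an eigenvector of y_m. Each step strips the outermost pair of factors, which meet as T(u,
    s) T(s, u) and give one factor of [gc]; y_1 = 1 leaves u - 1. *)
Lemma gwt_fusion w m s u : (m < N)%N -> q != 0 ->
  (forall k, (0 < k <= m)%N -> u != s k) -> gwt w m s ->
  w * (u%:A - gjm m.+1) * gupV m * gZ s u m = ((u - 1) * gc s u m) *: w.
Proof.
elim: m w => [|m IH] w mN q0 us ws.
  rewrite /gc big_nil !mulr1 mulrBr mulr_algr mulr1.
  by rewrite -[X in _ - X]scale1r -scalerBl.
have usm : u != s m.+1 by apply: us; lia.
have [ws' E] := gwt_step mN usm ws.
rewrite [gupV _]/(gV m.+1 * gupV m) [gZ _ _ _]/(gZ s u m * gbaxter m.+1 (s m.+1) u).
rewrite !mulrA E IH //; try lia; last by move=> k km; apply: us; lia.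
rewrite -scalerAl -mulrA gbaxter_mul // mulr_algr scalerA.
by rewrite {2}/gc big_nat_recr //= mulrA.
Qed.

Lemma glong_gY s u m : (m < N)%N ->
  glong m * gY s u m = gupV m * gZ s u m * glong m.+1.
Proof.
move=> mN.
have -> : glong m = gupV m * glong m.+1 by rewrite glongS // mulrA gupV_gup // mul1r.
have shift k : (k <= m)%N -> glong m.+1 *
    \prod_(1 <= j < k.+1) gbaxter (m.+1 - j) (s j) u = gZ s u k * glong m.+1.
  elim: k => [|k IH] km; first by rewrite big_nil mulr1 mul1r.
  rewrite big_nat_recr // mulrA IH; last by lia.
  rewrite [gZ s u k.+1]/(gZ s u k * gbaxter k.+1 (s k.+1) u).
  have := @glong_shift m.+1 (m.+1 - k.+1) _ mN.
  rewrite subKn; last by lia.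
  move=> /(_ ltac:(lia)).
  move: (glong m.+1) => W shW; rewrite -!mulrA; congr (_ * _).
  rewrite /gbaxter /gV -scalerAl -scalerAr; congr (_ *: _).
  rewrite mulrBr mulrBl -!scalerAr -!scalerAl mulrBr mulrBl.
  by rewrite mulr_algr mulr_algl shW.
by rewrite -[LHS]mulrA -[RHS]mulrA -shift.
Qed.

End HeckeGens.
Arguments gjm : simpl never.

(** * Down-closed sets of cells *)

Definition downset (D : seq cell) : Prop :=
  forall i j, (i, j) \in D ->
  [/\ (0 < i)%N, (0 < j)%N, (1 < i)%N -> (i.-1, j) \in D
    & (1 < j)%N -> (i, j.-1) \in D].

Definition addcell (D : seq cell) (c : cell) : Prop := c \notin D /\ downset (c :: D).

(* Standard tableaux as lists of cells, the most recent cell first. *)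
Fixpoint std (r : seq cell) : Prop :=
  if r is c :: r' then addcell r' c /\ std r' else True.

Lemma downset_le D i j i' j' : downset D -> (i, j) \in D ->
  (0 < i' <= i)%N -> (0 < j' <= j)%N -> (i', j') \in D.
Proof.
move=> dD; elim: i => [|i IHi] ijD ii' jj'; first by lia.
case: (ltnP i i') => [lii | le_ii]; last first.
  by apply: IHi => //; have [_ _ /(_ ltac:(lia)) + _] := dD _ _ ijD; last by lia.
have -> : i' = i.+1 by lia.
elim: j ijD jj' {IHi} => [|j IHj] ijD jj'; first by lia.
case: (ltnP j j') => [ljj | le_jj]; first by have -> : j' = j.+1 by lia.
by apply: IHj; [have [_ _ _ /(_ ltac:(lia))] := dD _ _ ijD | lia].
Qed.

Lemma downset_eq D D' : D =i D' -> downset D -> downset D'.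
Proof. by move=> e dD i j; rewrite -!e; apply: dD. Qed.

(** If one of the two cells were weakly to the north-west of the other, it would already belong to
    [D]. So they lie strictly north-east and south-west of each other, and the contents differ by at
    least 2. *)
Lemma addcell_apart D c c' : downset D -> addcell D c -> addcell D c' -> c != c' ->
  (content c' + 1 < content c) || (content c + 1 < content c').
Proof.
case: c c' => [i j] [i' j'] dD [cD dc] [c'D dc'] ne.
have [i0 j0 _ _] := dc i j (mem_head _ _).
have [i'0 j'0 _ _] := dc' i' j' (mem_head _ _).
have h1 : ~ ((i <= i')%N /\ (j <= j')%N).
  case=> ii jj; have : (i, j) \in (i', j') :: D.
    by apply: (downset_le dc' (mem_head _ _)); lia.
  by rewrite inE (negbTE ne) (negbTE cD).
have h2 : ~ ((i' <= i)%N /\ (j' <= j)%N).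
  case=> ii jj; have : (i', j') \in (i, j) :: D.
    by apply: (downset_le dc (mem_head _ _)); lia.
  by rewrite inE eq_sym (negbTE ne) (negbTE c'D).
by rewrite /content /=; lia.
Qed.

Lemma addcell_cons D c c' : addcell D c -> addcell D c' -> c != c' -> addcell (c :: D) c'.
Proof.
move=> [cD dc] [c'D dc'] ne; split; first by rewrite inE eq_sym (negbTE ne).
move=> i j; rewrite !inE orbA orbAC => /orP[h|/eqP h].
  have [|i0 j0 hi hj] := dc' i j; first by rewrite inE.
  by split=> // [/hi|/hj]; rewrite !inE => /orP[->|->]; rewrite ?orbT.
have [|i0 j0 hi hj] := dc i j; first by rewrite h mem_head.
by split=> // [/hi|/hj]; rewrite !inE => /orP[->|->]; rewrite ?orbT.
Qed.

Lemma std_uniq r : std r -> uniq r.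
Proof. by elim: r => //= c r IH [[-> _] /IH]. Qed.

Lemma std_downset r : std r -> downset r.
Proof. by case: r => [|c r] //= [[]]. Qed.

Definition corner (D : seq cell) (c : cell) : Prop :=
  [/\ c \in D, (c.1.+1, c.2) \notin D & (c.1, c.2.+1) \notin D].

Lemma downset_rem D b : uniq D -> downset D -> corner D b -> downset (rem b D).
Proof.
case: b => bi bj uD dD [bD /= b1 b2] i j; rewrite mem_rem_uniq // inE => /andP[ne ijD].
have [i0 j0 hi hj] := dD _ _ ijD.
split=> // [/[dup] i1 /hi|/[dup] j1 /hj]; rewrite mem_rem_uniq // inE => ->; rewrite andbT.
  apply/eqP => -[ei ej]; have := b1; rewrite -ei -ej prednK ?ijD //; lia.
apply/eqP => -[ei ej]; have := b2; rewrite -ei -ej prednK ?ijD //; lia.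
Qed.

(** Ensures that the intertwiner exchanging the weights of c and b is injective on weight vectors,
    so that a corner can be moved to the end. *)
Lemma corner_apart r c b : std (c :: r) -> corner (c :: r) b -> b \in r ->
  content c != content b /\ content c != content b + 1 /\ content c != content b - 1.
Proof.
case: c b => [i j] [bi bj] [[cr dc] sr] [bD b1 b2] br.
have [i0 j0 _ _] := dc _ _ (mem_head _ _).
have [bi0 bj0 _ _] := dc _ _ bD.
have h1 : ~ ((i <= bi)%N /\ (j <= bj)%N).
  case=> ii jj; move: cr; rewrite (downset_le (std_downset sr) br) //; lia.
have h2 : ~ ((bi.+1 <= i)%N /\ (bj <= j)%N).
  by case=> ii jj; move: b1; rewrite (downset_le dc (mem_head _ _)) //=; lia.
have h3 : ~ ((bi <= i)%N /\ (bj.+1 <= j)%N).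
  by case=> ii jj; move: b2; rewrite (downset_le dc (mem_head _ _)) //=; lia.
by rewrite /content /=; lia.
Qed.

Lemma std_rem r b : std r -> corner r b -> std (rem b r) /\ addcell (rem b r) b.
Proof.
move=> sr cb; have ur := std_uniq sr; have dr := std_downset sr.
split; last first.
  split; first by rewrite mem_rem_uniq // inE eqxx.
  by apply: downset_eq dr => x; apply: perm_mem; apply: perm_to_rem; case: cb.
elim: r sr cb ur dr => //= c r IH [[cr dc] sr] [bD b1 b2] /andP[_ ur] _.
case: eqP => [// | /eqP ne].
have br : b \in r by move: bD; rewrite inE eq_sym (negbTE ne).
have cb : corner r b.
  by split=> //; [move: b1|move: b2]; rewrite inE negb_or => /andP[].
split; last by apply: IH => //; apply: std_downset.
have e : rem b (c :: r) = c :: rem b r by rewrite /= (negbTE ne).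
split; first by apply: contra cr; apply: mem_rem.
by rewrite -e; apply: downset_rem => //=; rewrite cr.
Qed.

(** The cell to the right of c is blocked only by a missing cell above it; the cell above c is then
    a corner of r. An inadmissible content next to that of c is thus always the content of a corner,
    the situation of [bounded_adjacent]. *)
Lemma addcell_next_right r c : std (c :: r) -> ~ addcell (c :: r) (c.1, c.2.+1) ->
  corner r (c.1.-1, c.2) /\ content (c.1.-1, c.2) = content c + 1.
Proof.
case: c => i j /= [[cr dc] sr] na; have [i0 j0 hi hj] := dc _ _ (mem_head _ _).
have dr := std_downset sr.
have nr j' : (j <= j')%N -> (i, j') \notin r.
  by move=> jj; apply: contra cr => h; apply: (downset_le dr h); lia.
have [i1 nij] : (1 < i)%N /\ (i.-1, j.+1) \notin r.
  apply: contra_notP na => h; split.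
    by rewrite inE xpair_eqE eqxx /= negb_or nr // andbT; lia.
  move=> i' j'; rewrite inE => /predU1P[[-> ->]|h'].
    split=> //= h1; last by rewrite !inE eqxx orbT.
    rewrite !inE; case: (boolP (_ \in r)) => [_|h2]; rewrite ?orbT //.
    by case: h; split.
  have [i'0 j'0 hi' hj'] := dc i' j' h'.
  by split=> // [/hi'|/hj'] h1; rewrite inE h1 orbT.
have {hi} := hi i1; rewrite inE xpair_eqE => /orP[/andP[/eqP]|hi]; first by lia.
split=> //; last by rewrite /content /=; lia.
by split=> //=; rewrite prednK ?cr.
Qed.

Lemma addcell_next_down r c : std (c :: r) -> ~ addcell (c :: r) (c.1.+1, c.2) ->
  corner r (c.1, c.2.-1) /\ content (c.1, c.2.-1) = content c - 1.
Proof.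
case: c => i j /= [[cr dc] sr] na; have [i0 j0 hi hj] := dc _ _ (mem_head _ _).
have dr := std_downset sr.
have nr i' : (i <= i')%N -> (i', j) \notin r.
  by move=> jj; apply: contra cr => h; apply: (downset_le dr h); lia.
have [j1 nij] : (1 < j)%N /\ (i.+1, j.-1) \notin r.
  apply: contra_notP na => h; split.
    by rewrite inE xpair_eqE eqxx /= andbT negb_or nr // andbT; lia.
  move=> i' j'; rewrite inE => /predU1P[[-> ->]|h'].
    split=> //= h1; first by rewrite !inE eqxx orbT.
    rewrite !inE; case: (boolP (_ \in r)) => [_|h2]; rewrite ?orbT //.
    by case: h; split.
  have [i'0 j'0 hi' hj'] := dc i' j' h'.
  by split=> // [/hi'|/hj'] h1; rewrite inE h1 orbT.
have {hj} := hj j1; rewrite inE xpair_eqE => /orP[/andP[_ /eqP]|hj]; first by lia.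
split=> //; last by rewrite /content /=; lia.
by split=> //=; rewrite prednK ?cr.
Qed.

(** * Joint spectrum of the Jucys-Murphy elements *)

Definition generic (F : fieldType) (q : F) : Prop :=
  q != 0 /\ forall z : int, q ^ z = 1 -> z = 0.

Section Spectrum.
Variables (F : fieldType) (q : F) (B : algType F) (N : nat) (T : nat -> B).
Hypothesis TH : hecke_gens q N T.
Hypothesis qG : generic q.

Definition qc (d : int) : F := q ^ (2 * d).

Lemma q_neq0 : q != 0. Proof. by case: qG. Qed.
Hint Resolve q_neq0 : core.

Lemma qc_neq0 d : qc d != 0. Proof. exact: expfz_neq0. Qed.
Hint Resolve qc_neq0 : core.

Lemma expfz_inj : injective (fun z : int => q ^ z).
Proof.
move=> x y /= e; apply/eqP; rewrite -subr_eq0; apply/eqP; apply: (proj2 qG).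
by rewrite expfzDr // e -expfzDr // subrr.
Qed.

Lemma qc_inj : injective qc.
Proof. by move=> x y /expfz_inj; lia. Qed.

Lemma qcD1 d : qc (d + 1) = q ^+ 2 * qc d.
Proof. by rewrite /qc mulrDr expfzDr // mulrC. Qed.

Lemma qcB1 d : qc (d - 1) = q ^- 2 * qc d.
Proof. by rewrite /qc mulrBr expfzDr // mulrC. Qed.

(** 1 + q^2 = 0 would give q^4 = 1. This sum is the factor that separates the scalars [la] and [mu]
    in [bounded_zigzag]. *)
Lemma qc_add_neq0 c d : c = d + 1 \/ c = d - 1 -> qc d + qc c != 0.
Proof.
have q2 : 1 + q ^+ 2 != 0.
  rewrite addrC addr_eq0; apply/eqP => e; have : (4 : int) = 0; last by [].
  apply: (proj2 qG); rewrite -[LHS]/(q ^+ (2 * 2)) exprM e; ring.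
case=> ->; rewrite ?qcD1 ?qcB1.
  by rewrite -[X in X + _]mul1r -mulrDl mulf_neq0.
rewrite -[X in X + _]mul1r -mulrDl mulf_neq0 //.
by rewrite -(mulfV (expf_neq0 2 q_neq0)) -[X in _ + X]mul1r
  -mulrDl mulf_neq0 ?invr_eq0 ?expf_neq0 // addrC.
Qed.

Lemma qsub_neq0 : q - q^-1 != 0.
Proof.
rewrite subr_eq0; apply/eqP => e; have : (2 : int) = 0; last by [].
by apply: (proj2 qG); rewrite -[LHS]/(q * q) {2}e mulfV.
Qed.

Local Notation y := (gjm T).
Local Notation k := (q - q^-1).

(* Weights are listed like standard tableaux, the last one first. *)
Fixpoint rwt (w : B) (s : seq int) : Prop :=
  if s is d :: s' then w * y (size s) = qc d *: w /\ rwt w s' else True.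

Definition rootprod (L : seq int) (Z : B) : B := \prod_(d <- L) (Z - (qc d)%:A).

Lemma rootprod_comm L Z x : x * Z = Z * x -> x * rootprod L Z = rootprod L Z * x.
Proof.
move=> xZ; rewrite /rootprod; elim: L => [|d L IH]; first by rewrite big_nil mulr1 mul1r.
have xd : x * (Z - (qc d)%:A) = (Z - (qc d)%:A) * x.
  by rewrite mulrBr mulrBl xZ mulr_algr mulr_algl.
by rewrite big_cons mulrA xd -mulrA IH mulrA.
Qed.

Lemma rootprod_cat L1 L2 Z : rootprod (L1 ++ L2) Z = rootprod L1 Z * rootprod L2 Z.
Proof. exact: big_cat. Qed.

Lemma rootprod_rem L d Z : d \in L ->
  rootprod L Z = (Z - (qc d)%:A) * rootprod (rem d L) Z.
Proof.
elim: L => //= e L IH; rewrite inE eq_sym; case: eqVneq => [-> _|_ /= dL].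
  exact: big_cons.
rewrite /rootprod !big_cons -!/(rootprod _ _) IH // !mulrA; congr (_ * _).
by rewrite mulrBl [RHS]mulrBr mulr_algl mulr_algr mulrBr mulrBl mulr_algl mulr_algr.
Qed.

Lemma rootprod_eigen L Z w a : w * Z = a *: w ->
  w * rootprod L Z = (\prod_(d <- L) (a - qc d)) *: w.
Proof.
move=> wZ; rewrite /rootprod; elim: L => [|d L IH].
  by rewrite !big_nil mulr1 scale1r.
by rewrite !big_cons mulrA mulrBr wZ mulr_algr -scalerBl -scalerAl IH scalerA.
Qed.

Lemma rwt_mul w s x :
  (forall i, (0 < i <= size s)%N -> x * y i = y i * x) -> rwt w s -> rwt (w * x) s.
Proof.
elim: s => //= d s IH cx [wd ws]; split.
  by rewrite -mulrA cx ?leqnn // mulrA wd scalerAl.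
by apply: IH => // i ii; apply: cx; lia.
Qed.

(** Distinctness of the roots makes the next Jucys-Murphy element diagonalizable on vectors with
    weights [r]; [bounded_neq] depends on it. *)
Definition bounded (r : seq cell) : Prop := exists L : seq int,
  [/\ uniq L, forall d, d \in L -> exists2 c, addcell r c & content c = d
    & forall w, rwt w (map content r) -> w * rootprod L (y (size r).+1) = 0].

Lemma bounded_content r w d : bounded r -> w != 0 ->
  rwt w (d :: map content r) -> exists2 c, addcell r c & content c = d.
Proof.
case=> L [_ La Lk] w0 /= [wd wr]; apply: La.
have := Lk w wr; rewrite size_map in wd; rewrite (rootprod_eigen L wd) => /eqP.
rewrite scaler_eq0 (negbTE w0) orbF prodf_seq_eq0 => /hasP[d' d'L /=].
by rewrite subr_eq0 => /eqP/qc_inj ->.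
Qed.

Lemma jmT n : (0 < n < N)%N -> y n.+1 * gV q T n = T n * y n.
Proof. by move=> nN; rewrite gjmS ?(andP nN).1 // -!mulrA (gmulV TH) // mulr1. Qed.

Lemma Tjm n : (0 < n < N)%N -> gV q T n * y n.+1 = y n * T n.
Proof. by move=> nN; rewrite gjmS ?(andP nN).1 // !mulrA (gVmul TH) // mul1r. Qed.

Lemma T_jmS n : (0 < n < N)%N -> T n * y n.+1 = y n * T n + k *: y n.+1.
Proof.
move=> nN; rewrite -[T n](subrK k%:A) -/(gV q T n) mulrDl mulr_algl Tjm //.
by rewrite /gV subrK.
Qed.

(** On the span of w and w T_n both y_n and y_(n+1) are triangular with eigenvalues a and b; w' is
    the combination that carries them in the opposite order. The last clause says when w can be
    recovered from w'. *)
Lemma swap_eigen n w a b : (0 < n < N)%N -> w * y n = a *: w -> w * y n.+1 = b *: w ->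
  let w' := w * ((b - a) *: T n - (k * b)%:A) in
  [/\ w' * y n = b *: w', w' * y n.+1 = a *: w' &
      w' * ((a - b) *: T n - (k * a)%:A) = (k ^+ 2 * (a * b) - (a - b) ^+ 2) *: w].
Proof.
move=> nN wa wb; set t := w * T n.
have tX : t * y n = b *: t - (k * b) *: w.
  rewrite /t -mulrA -jmT // mulrA wb -scalerAl /gV mulrBr mulr_algr scalerBr.
  by rewrite scalerA (mulrC b).
have tY : t * y n.+1 = a *: t + (k * b) *: w.
  by rewrite /t -mulrA T_jmS // mulrDr mulrA wa -scalerAl -scalerAr wb scalerA.
have w'E : w * ((b - a) *: T n - (k * b)%:A) = (b - a) *: t - (k * b) *: w.
  by rewrite mulrBr -scalerAr mulr_algr.
have tT : t * T n = w + k *: t by rewrite -mulrA (gquad TH) // mulrDr mulr1 -scalerAr.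
rewrite /= w'E; split.
- rewrite mulrBl -!scalerAl tX wa !scalerBr !scalerA -addrA -opprD -scalerDl.
  by congr (_ *: _ - _ *: _); ring.
- rewrite mulrBl -!scalerAl tY wb !scalerBr !scalerDr !scalerA -addrA -scalerBl.
  by rewrite -scaleNr; congr (_ *: _ + _ *: _); ring.
rewrite mulrBr mulr_algr -scalerAr mulrBl -!scalerAl tT scalerDr scalerBr.
rewrite -/t opprB !scalerN !scalerDr !scalerA -!scaleNr.
rewrite [LHS](AC (3 * 2) ((1 * 4) * (2 * 3 * 5))) /= -!scalerDl.
rewrite [X in _ + X *: t](_ : _ = 0); last by ring.
by rewrite scale0r addr0; congr (_ *: _); ring.
Qed.

(* The scalar by which the square of the intertwiner of [swap_eigen] acts. *)
Lemma swap_coef_neq0 c d : c != d + 1 -> c != d - 1 ->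
  k ^+ 2 * (qc c * qc d) - (qc c - qc d) ^+ 2 != 0.
Proof.
move=> c1 c2.
have -> : k ^+ 2 * (qc c * qc d) - (qc c - qc d) ^+ 2 =
    - ((qc c - qc (d + 1)) * (qc c - qc (d - 1))).
  by rewrite qcD1 qcB1; field.
rewrite oppr_eq0 mulf_eq0 !subr_eq0 negb_or.
by rewrite !(inj_eq qc_inj) c1.
Qed.

Lemma rwt_swap s c d w : ((size s).+2 <= N)%N -> rwt w (d :: c :: s) ->
  let w' := w * ((qc d - qc c) *: T (size s).+1 - (k * qc d)%:A) in
  rwt w' (c :: d :: s) /\ (w' = 0 -> c != d + 1 -> c != d - 1 -> w = 0).
Proof.
move=> sN [wd [wc ws]] /=.
have [e1 e2 e3] := swap_eigen (n := (size s).+1) ltac:(lia) wc wd.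
split; last first.
  move=> w'0 c1 c2; move: e3; rewrite w'0 mul0r => /esym/eqP.
  by rewrite scaler_eq0 (negbTE (swap_coef_neq0 _ _)) // => /eqP.
split; [exact: e2 | split; [exact: e1|]].
apply: rwt_mul => // i ii; rewrite mulrBl mulrBr mulr_algl mulr_algr.
by rewrite -scalerAl -scalerAr (gcomm_jm TH) //; lia.
Qed.

(** With equal weights, v T_n (y_n - c) is a nonzero multiple of v, so v and v T_n would form a
    Jordan block of y_n. This contradicts the simple roots of [bounded], since v T_n still has the
    weights of [r]. *)
Lemma bounded_neq r v c : ((size r).+2 <= N)%N -> bounded r ->
  rwt v [:: c, c & map content r] -> v = 0.
Proof.
move=> rN br vw; apply/eqP; apply/negPn/negP => v0.
have [_ [vX vr]] := vw; move: vw => [vY _].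
have nN : (0 < (size r).+1 < N)%N by lia.
rewrite /= size_map in vX vY.
case: br => L [uL La Lk].
have cL : c \in L.
  have := Lk v vr; rewrite (rootprod_eigen L vX) => /eqP.
  rewrite scaler_eq0 (negbTE v0) orbF prodf_seq_eq0 => /hasP[d' d'L /=].
  by rewrite subr_eq0 => /eqP/qc_inj ->.
have := Lk (v * T (size r).+1); set X := y (size r).+1 in vX *.
have -> : (v * T (size r).+1) * rootprod L X =
    (- (k * qc c) * \prod_(d <- rem c L) (qc c - qc d)) *: v.
  rewrite (rootprod_rem _ cL) mulrA.
  have -> : v * T (size r).+1 * (X - (qc c)%:A) = - (k * qc c) *: v.
    rewrite mulrBr mulr_algr -mulrA -jmT // mulrA vY -scalerAl /gV mulrBr mulr_algr.
    by rewrite scalerBr scalerA addrAC subrr add0r scaleNr (mulrC k).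
  by rewrite -scalerAl (rootprod_eigen _ vX) scalerA.
move=> h; have {h} /eqP : (- (k * qc c) * \prod_(d <- rem c L) (qc c - qc d)) *: v = 0.
  apply: h; apply: rwt_mul => // i; rewrite size_map => ii.
  by rewrite (gcomm_jm TH) //; lia.
rewrite scaler_eq0 (negbTE v0) orbF mulf_eq0.
rewrite oppr_eq0 !mulf_eq0 (negbTE qsub_neq0) (negbTE (qc_neq0 c)) /=.
rewrite prodf_seq_eq0 => /hasP[d]; rewrite mem_rem_uniq // inE => /andP[dc _] /=.
by rewrite subr_eq0 (inj_eq qc_inj) eq_sym (negbTE dc).
Qed.

(* Two adjacent contents cannot alternate: both transposed weights repeat a content
   or are excluded by [r], so that T_n and T_(n+1) act on [v] by different
   scalars, against the braid relation. *)
Lemma bounded_zigzag r v b c : ((size r).+3 <= N)%N -> std r -> bounded r ->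
  addcell r b ->
  c = content b + 1 \/ c = content b - 1 ->
  rwt v [:: content b, c, content b & map content r] -> v = 0.
Proof.
move=> rN sr br ab cE vw; apply/eqP; apply/negPn/negP => v0.
set d := content b in cE vw *; set n := (size r).+1.
have [v3 vw2] := vw; have [v2 [v1 vr]] := vw2.
rewrite /= size_map -/n in v1 v2 v3.
have n1 : (0 < n < N)%N by rewrite /n; lia.
have n2 : (0 < n.+1 < N)%N by rewrite /n; lia.
have E1 : v * ((qc c - qc d) *: T n - (k * qc c)%:A) = 0.
  have := @rwt_swap (map content r) d c v; rewrite size_map => /(_ ltac:(lia) vw2) [ws _].
  apply/eqP; apply/negPn/negP => v'0.
  have [e ae ce] := bounded_content br v'0 ws.2.
  have := addcell_apart (std_downset sr) ab ae; rewrite ce -/d.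
  have -> : b != e by apply/eqP => be; move: ce; rewrite -be -/d; lia.
  by move=> /(_ isT); lia.
have E2 : v * ((qc d - qc c) *: T n.+1 - (k * qc d)%:A) = 0.
  apply: (@bounded_neq r _ d (ltnW rN) br).
  have sN : ((size (d :: map content r)).+2 <= N)%N by rewrite /= size_map.
  by have [[_ ws] _] := rwt_swap sN vw; rewrite /n -(size_map content); apply: ws.
set a := qc d in E1 E2; set a' := qc c in E1 E2.
have a0 : a - a' != 0 by rewrite subr_eq0 (inj_eq qc_inj); lia.
have a'0 : a' - a != 0 by rewrite subr_eq0 (inj_eq qc_inj); lia.
set la := k * a' / (a' - a); set mu := k * a / (a - a').
have Tn : v * T n = la *: v.
  apply: (scalerI a'0); rewrite scalerA mulrC divfK // scalerAr.
  by apply/eqP; rewrite -subr_eq0 -[X in _ - X]mulr_algr -mulrBr E1.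
have Tn1 : v * T n.+1 = mu *: v.
  apply: (scalerI a0); rewrite scalerA mulrC divfK // scalerAr.
  by apply/eqP; rewrite -subr_eq0 -[X in _ - X]mulr_algr -mulrBr E2.
have : v * (T n * T n.+1 * T n) = v * (T n.+1 * T n * T n.+1).
  by case: TH => -> //; rewrite /n; lia.
rewrite !mulrA Tn Tn1 -!scalerAl Tn Tn1 -!scalerAl Tn Tn1 !scalerA => /eqP.
rewrite -subr_eq0 -scalerBl scaler_eq0 (negbTE v0) orbF.
have -> : la * mu * la - mu * la * mu =
    k ^+ 3 * a * a' * (a + a') / ((a' - a) * (a - a') * (a' - a)).
  by rewrite /la /mu; field; rewrite a0 a'0 q_neq0.
rewrite !mulf_eq0 !invr_eq0 !mulf_eq0 (negbTE a0) (negbTE a'0) !orbF.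
rewrite ?expf_eq0 (negbTE qsub_neq0) !(negbTE (qc_neq0 _)) /=.
by rewrite (negbTE (qc_add_neq0 cE)).
Qed.

(* [x] is a product of intertwiners moving [b] past the cells added after it. *)
Lemma rwt_corner r b w : std r -> corner r b -> (size r <= N)%N ->
  w != 0 -> rwt w (map content r) -> exists x : B,
  [/\ w * x != 0, rwt (w * x) (map content (b :: rem b r))
    & forall i, (size r < i <= N)%N -> x * y i = y i * x].
Proof.
elim: r => [|c r IH] sr cb rN w0 wr; first by case: cb.
case: (eqVneq c b) => [cb' | cb'].
  exists 1; rewrite mulr1 /= cb' eqxx -{1}cb'; split=> // i _.
  by rewrite mulr1 mul1r.
have br : b \in r by case: cb; rewrite inE eq_sym (negbTE cb').
have [n1 [n2 n3]] := corner_apart sr cb br.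
have cbr : corner r b.
  by case: cb => _ b1 b2; split=> //; [move: b1|move: b2]; rewrite inE negb_or => /andP[].
have [x [wx0 wxr cx]] := IH sr.2 cbr (ltnW rN) w0 wr.2.
have sb : size (rem b r) = (size r).-1 by rewrite size_rem.
have r0 : (0 < size r)%N by case: (r) br.
have wxc : rwt (w * x) [:: content c, content b & map content (rem b r)].
  split=> //=; rewrite size_map sb prednK //.
  have /= := wr.1; rewrite size_map -mulrA cx; last by move: rN => /=; lia.
  by rewrite mulrA => ->; rewrite scalerAl.
have := @rwt_swap (map content (rem b r)) (content b) (content c) (w * x).
rewrite size_map sb prednK // => /(_ ltac:(move: rN => /=; lia) wxc).
set x' := _ - _; move=> [wx'r wx'0].
exists (x * x'); rewrite mulrA; split.
- apply/eqP => e; move: wx0; rewrite wx'0 ?eqxx //; lia.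
- by rewrite /= (negbTE cb').
move=> i /= ii; have cx' : x' * y i = y i * x'.
  by rewrite /x' mulrBl mulrBr mulr_algl mulr_algr -scalerAl -scalerAr (gcomm_jm TH) //; lia.
by rewrite -!mulrA cx' !mulrA cx //; lia.
Qed.

(** * The intertwiner of y_n and y_(n+1) as an element of the algebra *)

Section Intertwiner.
Variable n : nat.
Hypothesis nN : (0 < n < N)%N.
Let X := y n.
Let Y := y n.+1.
Let phi := (Y - X) * T n - k *: Y.

Let XY : X * Y = Y * X. Proof. by apply: (gjmC TH); lia. Qed.

Lemma phi_jm : phi * X = Y * phi.
Proof.
have e1 : (Y - X) * Y = Y * (Y - X) by rewrite mulrBl mulrBr XY.
rewrite /phi mulrBl -mulrA -jmT // -/Y mulrA e1 /gV mulrBr mulr_algr -scalerAl.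
by rewrite [RHS]mulrBr -scalerAr mulrA -addrA -opprD -scalerDr -mulrDr subrK.
Qed.

Lemma phi_rootprod L : phi * rootprod L X = rootprod L Y * phi.
Proof.
rewrite /rootprod; elim: L => [|d L IH]; first by rewrite !big_nil mulr1 mul1r.
have e : phi * (X - (qc d)%:A) = (Y - (qc d)%:A) * phi.
  by rewrite mulrBr phi_jm mulr_algr mulrBl mulr_algl.
by rewrite !big_cons mulrA e -mulrA IH mulrA.
Qed.

(** If z were an eigenvector of y_(n+1) too, the scalar of [swap_eigen] would have to vanish, and
    [swap_coef_neq0] factors it with roots q^2 a and q^-2 a. The proof obtains the same quadratic
    equation without that assumption, using the relation z phi = 0 for z and for z (y_(n+1) - a). *)
Lemma phi_kernel z c : z * X = qc c *: z -> z * phi = 0 ->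
  z * rootprod [:: c + 1; c - 1] Y = 0.
Proof.
set a := qc c => zX zp.
have step v : v * X = a *: v -> v * phi = 0 ->
    (v * Y - a *: v) * T n = k *: (v * Y) /\ v * Y - a *: v = (k * a) *: (v * T n).
  move=> vX vp.
  have e : (v * Y - a *: v) * T n = k *: (v * Y).
    move/eqP: vp; rewrite /phi mulrBr -scalerAr mulrA mulrBr vX subr_eq0.
    by move/eqP.
  split=> //; move: (v * Y - a *: v) (subrK (a *: v) (v * Y)) e => v1 dv e.
  have : v1 * (T n * T n) = k *: (v * Y) * T n by rewrite mulrA e.
  rewrite (gquad TH) // mulrDr mulr1 -scalerAr -dv -scalerAl mulrDl scalerDr addrC.
  by move/addrI => ->; rewrite -scalerAl scalerA.
have [e1 e2] := step z zX zp.
set z1 := z * Y - a *: z in e1 e2.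
have z1X : z1 * X = a *: z1.
  by rewrite /z1 mulrBl -mulrA -XY mulrA zX -!scalerAl zX scalerBr.
have z1p : z1 * phi = 0.
  by rewrite /z1 mulrBl -mulrA -phi_jm mulrA zp -scalerAl zp mul0r scaler0 subr0.
have [_ e3] := step z1 z1X z1p.
rewrite e1 scalerA in e3.
rewrite /rootprod !big_cons big_nil mulr1 mulrA [z * _]mulrBr mulr_algr.
have z1Y : z1 * Y = (k * a * k + a) *: (z * Y) - (a * a) *: z.
  by rewrite -[z1 * Y](subrK (a *: z1)) e3 /z1 scalerBr !scalerA addrA -scalerDl.
have PY : z * Y * Y = z1 * Y + a *: (z * Y) by rewrite /z1 mulrBl -scalerAl subrK.
rewrite mulrBr mulrBl PY z1Y mulr_algr -scalerAl scalerBr opprB scalerA -!scaleNr.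
rewrite [LHS](AC (4 * 2) ((1 * 3 * 4 * 6) * (2 * 5))) /= -!scalerDl qcD1 qcB1 -/a.
rewrite [X in X *: _ + _](_ : _ = 0); last by field.
rewrite [X in _ + X *: _](_ : _ = 0); last by field.
by rewrite !scale0r addr0.
Qed.

End Intertwiner.
(** Since w phi still has the weights of [r], the old polynomial in y_n kills it; moved across phi,
    this says that w times the old polynomial in y_(n+1) lies in the kernel of phi, and [phi_kernel]
    adds the two roots next to content c. *)
Lemma bounded_pre r c w L : ((size r).+2 <= N)%N ->
  (forall w, rwt w (map content r) -> w * rootprod L (y (size r).+1) = 0) ->
  rwt w (content c :: map content r) ->
  w * rootprod (L ++ [:: content c + 1; content c - 1]) (y (size r).+2) = 0.
Proof.
move=> rN Lk [wX wr]; rewrite /= size_map in wX.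
have nN : (0 < (size r).+1 < N)%N by lia.
rewrite rootprod_cat mulrA; apply: phi_kernel => //.
  rewrite -mulrA -rootprod_comm; last by apply: (gjmC TH); lia.
  by rewrite mulrA wX scalerAl.
rewrite -mulrA -phi_rootprod // mulrA; apply: Lk; apply: rwt_mul wr => i.
rewrite size_map => ii.
have ci j : (i < j <= N)%N -> y j * y i = y i * y j by move=> ij; apply: (gjmC TH); lia.
rewrite mulrBl mulrBr -scalerAl -scalerAr ci; last by lia.
rewrite -mulrA (gcomm_jm TH); try lia.
by rewrite !mulrA mulrBl mulrBr !ci //; lia.
Qed.

Lemma rootprod_filter (s : seq int) (w : B) (L : seq int) (good : pred int) :
  ((size s).+1 <= N)%N -> rwt w s ->
  (forall d v, d \in L -> ~~ good d -> rwt v (d :: s) -> v = 0) ->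
  w * rootprod L (y (size s).+1) = 0 ->
  w * rootprod (filter good L) (y (size s).+1) = 0.
Proof.
move=> sN; elim: L w => //= d L IH w ws bad.
have bad' d' v : d' \in L -> ~~ good d' -> rwt v (d' :: s) -> v = 0.
  by move=> d'L; apply: bad; rewrite inE d'L orbT.
set Z := y _; have cZ : forall i, (0 < i <= size s)%N -> Z * y i = y i * Z.
  by move=> i ii; apply: (gjmC TH); lia.
rewrite {1}/rootprod big_cons -/(rootprod L Z) mulrA => H.
case: ifP => gd; last first.
  apply: IH => //; apply: (bad d); rewrite ?mem_head ?gd //; split.
    apply/eqP; rewrite -subr_eq0 -mulr_algr -mulrBr -mulrA -rootprod_comm ?mulrA ?H //.
    by rewrite mulrBl mulrBr mulr_algl mulr_algr.
  apply: rwt_mul ws => i ii; symmetry; apply: rootprod_comm.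
  by symmetry; apply: cZ.
rewrite /rootprod big_cons -/(rootprod _ Z) mulrA; apply: IH => //.
apply: rwt_mul ws => i ii.
by rewrite mulrBl mulrBr mulr_algl mulr_algr cZ.
Qed.

(** Moving the corner b behind the other cells of [r] turns the weights into b, c, b above those of
    [rem b r], the pattern excluded by [bounded_zigzag]. *)
Lemma bounded_adjacent r c b v : ((size r).+2 <= N)%N -> std r ->
  corner r b -> bounded (rem b r) -> content c = content b + 1 \/ content c = content b - 1 ->
  rwt v [:: content b, content c & map content r] -> v = 0.
Proof.
move=> rN sr cb bb cE vw; apply/eqP; apply/negPn/negP => v0.
have [v2 [v1 vr]] := vw; rewrite /= size_map in v1 v2.
have [x [vx0 vxr cx]] := rwt_corner sr cb (ltnW (ltnW rN)) v0 vr.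
have r0 : (0 < size r)%N by case: cb; case: (r).
have sb : size (rem b r) = (size r).-1 by rewrite size_rem //; case: cb.
have [s' ab] := std_rem sr cb.
suff : v * x = 0 by apply/eqP.
apply: (bounded_zigzag (r := rem b r) (b := b) (c := content c)) => //.
  by rewrite sb prednK.
split; [|split] => //; rewrite /= size_map sb prednK //.
  by rewrite -(mulrA v x) cx ?[LHS]mulrA ?v2 -?scalerAl //; lia.
by rewrite -(mulrA v x) cx ?[LHS]mulrA ?v1 -?scalerAl //; lia.
Qed.

(** Strong induction on the size, because the hypothesis is used for [rem b r], which need not be a
    tail of [r]. The candidates are the roots for [r] and the two neighbours of content c; repeated
    and inadmissible ones are filtered out. *)
Lemma bounded_std r : std r -> (size r < N)%N -> bounded r.
Proof.
have [n] := ubnP (size r); elim: n r => // n IH [|c r] /= rn sr rN.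
  exists [:: 0]; split=> // [d|w _].
    rewrite inE => /eqP ->; exists (1, 1)%N => //; split=> // i j.
    by rewrite inE => /eqP[-> ->].
  by rewrite /rootprod big_seq1 /qc mulr0 expr0z scale1r subrr mulr0.
have [ac sr'] := sr; have dr := std_downset sr'.
have [L [uL La Lk]] : bounded r by apply: IH => //; apply: ltnW.
case: (boolP (content c \in L)) => cL; last first.
  (* Content c is not a root for [r], so only the zero vector has these weights and the empty
     product kills it. *)
  exists [::]; split=> // w [wX wr]; rewrite /rootprod big_nil mulr1.
  rewrite /= size_map in wX; have /eqP := Lk w wr; rewrite (rootprod_eigen L wX).
  rewrite scaler_eq0 => /orP[|/eqP //]; rewrite prodf_seq_eq0 => /hasP[d dL /=].
  by rewrite subr_eq0 (inj_eq qc_inj) => /eqP e; rewrite e dL in cL.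
have far d : d \in L -> d != content c -> d != content c + 1 /\ d != content c - 1.
  move=> /La[e ae <-] ne; have := addcell_apart dr ae ac.
  have -> : e != c by apply: contra ne => /eqP ->.
  by move=> /(_ isT); lia.
pose good := [pred d : int | `[< exists2 e, addcell (c :: r) e & content e = d >]].
exists (filter good (L ++ [:: content c + 1; content c - 1])); split.
- apply: filter_uniq; rewrite cat_uniq uL /= inE orbF andbT; apply/andP; split; last lia.
  by apply/negP => /orP[] dL; have := far _ dL; lia.
- by move=> d; rewrite mem_filter => /andP[/asboolP].
have sM : size (content c :: map content r) = (size r).+1 by rewrite /= size_map.
move=> w ws; have := @rootprod_filter (content c :: map content r) w
  (L ++ [:: content c + 1; content c - 1]) good; rewrite sM.
move=> filt; apply: filt => //; last exact: bounded_pre.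
have brem b : corner r b -> bounded (rem b r).
  move=> cb; have [s' _] := std_rem sr' cb.
  have e : size (rem b r) = (size r).-1 by rewrite size_rem //; case: cb.
  by apply: IH => //; rewrite e; lia.
have gP d e : addcell (c :: r) e -> content e = d -> good d.
  by move=> ae ed; apply/asboolP; exists e.
move=> d v; rewrite mem_cat !inE => dL /negP ng vw.
case: (eqVneq d (content c)) => [ed | nd].
  by apply: (@bounded_neq r v (content c)) => //; [exists L | rewrite -{1}ed].
case/orP: dL => [/La[e ae ee] | dL].
  case: ng; apply: (gP d e) => //; apply: addcell_cons => //.
  by apply: contra nd => /eqP ->; rewrite ee.
case/orP: dL => /eqP dE.
  have [|cb ce] := addcell_next_right sr.
    by move=> a; apply: ng; apply: gP a _; rewrite dE /content /=; lia.
  apply: (@bounded_adjacent r c _ v rN sr' cb (brem _ cb)); last by rewrite ce -dE.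
  by right; rewrite ce addrK.
have [|cb ce] := addcell_next_down sr.
  by move=> a; apply: ng; apply: gP a _; rewrite dE /content /=; lia.
apply: (@bounded_adjacent r c _ v rN sr' cb (brem _ cb)); last by rewrite ce -dE.
by left; rewrite ce subrK.
Qed.

(** [bounded] yields contents of some addable cells, whereas the idempotents are defined with all of
    them. *)
Lemma rootprod_subset L0 L Z : uniq L0 -> uniq L -> {subset L0 <= L} ->
  exists R, rootprod L Z = rootprod L0 Z * R.
Proof.
elim: L0 L => [|d L0 IH] L; first by exists (rootprod L Z); rewrite /rootprod big_nil mul1r.
move=> /= /andP[dL0 uL0] uL sL.
have dL : d \in L by apply: sL; rewrite mem_head.
have [||e eL0|R ER] := IH (rem d L) => //; first exact: rem_uniq.
  rewrite mem_rem_uniq // inE sL ?inE ?eL0 ?orbT // andbT.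
  by apply: contra dL0 => /eqP <-.
by exists R; rewrite (rootprod_rem _ dL) ER mulrA /rootprod big_cons.
Qed.

(** Lagrange interpolation: the projection of w to the eigenvalue [qc d] of Z. The inductive
    definition of the idempotents has the same shape. *)
Definition eigenpart (L : seq int) (Z w : B) (d : int) : B :=
  (\prod_(e <- rem d L) (qc d - qc e))^-1 *: (w * rootprod (rem d L) Z).

Lemma eigenpartP L Z w d : d \in L -> w * rootprod L Z = 0 ->
  eigenpart L Z w d * Z = qc d *: eigenpart L Z w d.
Proof.
move=> dL; rewrite (rootprod_rem _ dL) => H; apply/eqP.
rewrite -subr_eq0 -[X in _ - X]mulr_algr -mulrBr -scalerAl -mulrA -rootprod_comm.
  by rewrite H scaler0.
by rewrite mulrBl mulrBr mulr_algl mulr_algr.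
Qed.

Lemma eigenpart_sum L Z w : uniq L -> w * rootprod L Z = 0 ->
  w = \sum_(d <- L) eigenpart L Z w d.
Proof.
move=> uL wL.
(* Any decomposition into eigenvectors is enough: the product over the other roots kills every
   component but [v d], and the normalisation restores that one. *)
suff [v wv vZ] : exists2 v : int -> B, w = \sum_(d <- L) v d
    & forall d, d \in L -> v d * Z = qc d *: v d.
  rewrite [LHS]wv; apply: eq_big_seq => d dL; apply/esym.
  rewrite /eigenpart {1}wv mulr_suml [X in _ *: X](bigD1_seq d) //= (rootprod_eigen _ (vZ d dL)).
  rewrite [X in _ *: (_ + X)]big1_seq ?addr0 => [|e /andP[ed eL]]; last first.
    have eR : e \in rem d L by rewrite mem_rem_uniq // inE ed.
    by rewrite (rootprod_eigen _ (vZ e eL)) (big_rem _ eR) /= subrr mul0r scale0r.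
  rewrite scalerA mulVf ?scale1r //; rewrite prodf_seq_neq0; apply/allP => e.
  by rewrite mem_rem_uniq // inE => /andP[ed _]; rewrite subr_eq0 (inj_eq qc_inj) eq_sym.
elim: L w uL wL => [|d L IH] w /=.
  by rewrite /rootprod big_nil mulr1 => _ ->; exists (fun=> 0); rewrite ?big_nil.
move=> /andP[dL uL]; rewrite /rootprod big_cons mulrA => /(IH _ uL)[v wv vZ].
(* The components of w (Z - d), divided by their eigenvalues; what they leave of w is an eigenvector
   for d. *)
pose v' e := (qc e - qc d)^-1 *: v e.
exists (fun e => if e == d then w - \sum_(e <- L) v' e else v' e).
  rewrite big_cons eqxx [X in _ + X](eq_big_seq v') ?subrK // => e eL.
  by case: eqVneq => // ed; rewrite -ed eL in dL.
move=> e; rewrite inE; case: eqVneq => [-> _ | ed /= eL]; last first.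
  by rewrite /v' -scalerAl vZ // !scalerA mulrC.
apply/eqP; rewrite -subr_eq0 -[X in _ - X]mulr_algr -mulrBr mulrBl wv.
rewrite mulr_suml subr_eq0; apply/eqP; apply: eq_big_seq => f fL.
rewrite /v' -scalerAl mulrBr mulr_algr vZ // -scalerBl scalerA mulVf ?scale1r //.
by rewrite subr_eq0 (inj_eq qc_inj); apply: contra dL => /eqP <-.
Qed.

Lemma eigenpart_rwt L Z w d s : (forall i, (0 < i <= size s)%N -> Z * y i = y i * Z) ->
  rwt w s -> rwt (eigenpart L Z w d) s.
Proof.
move=> cZ ws; rewrite /eigenpart scalerAr; apply: rwt_mul ws => i ii.
rewrite -scalerAl -scalerAr; congr (_ *: _); symmetry; apply: rootprod_comm.
by symmetry; apply: cZ.
Qed.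

End Spectrum.

(** * Normal forms of words in the simple transpositions *)

(* A code [:: a_m; ...; a_1] with [a_k <= k] stands for the word which is the
   concatenation, over k = 1, ..., m, of k, k - 1, ..., k - a_k + 1. *)
Definition block (k a : nat) : seq nat := [seq (k - i)%N | i <- iota 0 a].

Fixpoint cword (c : seq nat) : seq nat :=
  if c is a :: c' then cword c' ++ block (size c').+1 a else [::].

Fixpoint vcode (c : seq nat) : bool :=
  if c is a :: c' then (a <= (size c').+1)%N && vcode c' else true.

(* The code of the product by the i-th transposition, if the length increases. *)
Fixpoint cstep (c : seq nat) (i : nat) : option (seq nat) :=
  if c is a :: c' then
    let k := (size c').+1 in
    if (i < k - a)%N then omap (cons a) (cstep c' i)
    else if i == (k - a)%N then Some (a.+1 :: c')
    else if i == (k - a).+1 then None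
    else omap (cons a) (cstep c' i.-1)
  else None.

Lemma blockS k a : block k a.+1 = rcons (block k a) (k - a)%N.
Proof. by rewrite /block -cats1 -addn1 iotaD map_cat. Qed.

Lemma size_block k a : size (block k a) = a.
Proof. by rewrite size_map size_iota. Qed.

Lemma cword_range c i : vcode c -> i \in cword c -> (0 < i <= size c)%N.
Proof.
elim: c i => //= a c IH i /andP[ac vc]; rewrite mem_cat => /orP[/(IH _ vc)|].
  by case/andP => ->; apply: leqW.
by case/mapP => j; rewrite mem_iota => /andP[_ ja] ->; lia.
Qed.

Lemma cstep_some c i c' : vcode c -> (0 < i <= size c)%N -> cstep c i = Some c' ->
  [/\ vcode c', size c' = size c & size (cword c') = (size (cword c)).+1].
Proof.
elim: c i c' => //= a c IH i c' /andP[ac vc] ii.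
case: ltnP => [ia | ai].
  case E: (cstep c i) => [c1|] //= -[<-].
  have [|v1 s1 w1] := IH _ _ vc _ E; first by lia.
  by rewrite /= !size_cat !size_block v1 s1 w1 ac addSn.
case: eqVneq => [e [<-] | n1].
  rewrite /= vc andbT; split=> //; first by lia.
  by rewrite !size_cat !size_block addnS.
case: eqVneq => // n2.
case E: (cstep c i.-1) => [c1|] //= -[<-].
have [|v1 s1 w1] := IH _ _ vc _ E; first by lia.
by rewrite /= !size_cat !size_block v1 s1 w1 ac addSn.
Qed.

(** When the length drops, the product is described by the code from which the step i leads back to
    c; no separate rule for descents is needed. *)
Lemma cstep_none c i : vcode c -> (0 < i <= size c)%N -> cstep c i = None ->
  exists c', [/\ vcode c', size c' = size c & cstep c' i = Some c].
Proof.
elim: c i => //= [|a c IH] i; first by lia.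
move=> /andP[ac vc] ii; case: ltnP => [ia | ai].
  case E: (cstep c i) => [c1|] //= _.
  have [|c' [v' s' e']] := IH _ vc _ E; first by lia.
  by exists (a :: c'); rewrite /= s' ac v' ia e'.
case: eqVneq => // n1; case: eqVneq => [e _ | n2].
  have a0 : (0 < a)%N by lia.
  exists (a.-1 :: c); rewrite /= vc; split=> //; first by rewrite andbT; lia.
  have -> : (i < (size c).+1 - a.-1)%N = false by lia.
  have -> : (i == (size c).+1 - a.-1)%N = true by lia.
  by rewrite prednK.
case E: (cstep c i.-1) => [c1|] //= _.
have [|c' [v' s' e']] := IH _ vc _ E; first by lia.
exists (a :: c'); rewrite /= s' ac v'; split=> //.
by rewrite ltnNge ai (negbTE n1) (negbTE n2) /= e'.
Qed.

(** * Consequences of the braid relations alone, used both for the T_i and for the transpositions *)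

Section BraidMonoid.
Variables (M : Type) (one : M) (op : Monoid.law one) (g : nat -> M) (N : nat).
Hypothesis braid : forall i, (0 < i)%N -> (i.+1 < N)%N ->
  op (op (g i) (g i.+1)) (g i) = op (op (g i.+1) (g i)) (g i.+1).
Hypothesis comm : forall i j, (0 < i)%N -> (i.+1 < j)%N -> (j < N)%N ->
  op (g i) (g j) = op (g j) (g i).

Let opA x y z : op x (op y z) = op (op x y) z. Proof. exact: Monoid.mulmA. Qed.

Definition wprod (r : seq nat) : M := \big[op/one]_(i <- r) g i.

Lemma wprod_cat r s : wprod (r ++ s) = op (wprod r) (wprod s).
Proof. exact: big_cat. Qed.

Lemma wprod_rcons r i : wprod (rcons r i) = op (wprod r) (g i).
Proof. by rewrite -cats1 wprod_cat /wprod big_seq1. Qed.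

Lemma wprod_block_low k a i : (k < N)%N -> (0 < i < k - a)%N ->
  op (wprod (block k a)) (g i) = op (g i) (wprod (block k a)).
Proof.
move=> kN; elim: a => [|a IH] ia.
  by rewrite /wprod big_nil Monoid.mul1m Monoid.mulm1.
rewrite blockS wprod_rcons -opA -(comm (i := i)); try lia.
by rewrite opA IH ?opA //; lia.
Qed.

(** A generator inside the range of a descending block, but not its last letter, emerges on the left
    with index lowered by one; hence the [i.-1] in [cstep]. *)
Lemma wprod_block_high k a i : (k < N)%N -> (a <= k)%N -> ((k - a).+1 < i <= k)%N ->
  op (wprod (block k a)) (g i) = op (g i.-1) (wprod (block k a)).
Proof.
move=> kN; elim: a => [|a IH] ak ii; first by lia.
case: (eqVneq i (k - a).+1) => [e | ne]; last first.
  rewrite blockS wprod_rcons -opA (comm (j := i)); try lia.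
  by rewrite opA IH ?opA //; lia.
case: a {IH} ak ii e => [|a] ak ii e; first by lia.
rewrite !blockS !wprod_rcons (_ : (k - a)%N = i); last by lia.
rewrite (_ : (k - a.+1)%N = i.-1); last by lia.
have := braid (i := i.-1) ltac:(lia); rewrite prednK; last by lia.
move=> /(_ ltac:(lia)) br.
have -> : op (op (op (wprod (block k a)) (g i)) (g i.-1)) (g i) =
    op (wprod (block k a)) (op (op (g i) (g i.-1)) (g i)) by rewrite !opA.
rewrite -br !opA; congr (op (op _ _) _).
by apply: wprod_block_low => //; lia.
Qed.

Lemma wprod_cstep c i c' : (size c < N)%N -> vcode c -> (0 < i <= size c)%N ->
  cstep c i = Some c' -> op (wprod (cword c)) (g i) = wprod (cword c').
Proof.
elim: c i c' => //= a c IH i c' cN /andP[ac vc] ii.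
case: ltnP => [ia | ai].
  case E: (cstep c i) => [c1|] //= -[<-].
  have [|_ s1 _] := cstep_some vc _ E; first by lia.
  rewrite /= s1 !wprod_cat -opA wprod_block_low //; last by lia.
  by rewrite opA (IH _ _ _ _ _ E) //; lia.
case: eqVneq => [e [<-] | n1].
  by rewrite /= !wprod_cat blockS wprod_rcons -e opA.
case: eqVneq => // n2.
case E: (cstep c i.-1) => [c1|] //= -[<-].
have [|_ s1 _] := cstep_some vc _ E; first by lia.
rewrite /= s1 !wprod_cat -opA wprod_block_high //; last by lia.
by rewrite opA (IH _ _ _ _ _ E) //; lia.
Qed.
End BraidMonoid.

(** * The spanning set of the T_w *)

Section StransWords.
Variable n : nat.

Definition sT (i : nat) : 'S_n := if insub i is Some j then @stransp n j else 1%g.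

Lemma sT_val i (x : 'I_n) : (0 < i < n)%N ->
  val (sT i x) = if x == i :> nat then i.-1 else if x == i.-1 :> nat then i else x.
Proof.
move=> iN; rewrite /sT; case: insubP => [j _ ej | ]; last by rewrite iN.
rewrite /stransp permE /=; case: eqVneq => [-> /= | /eqP n1].
  by rewrite ej eqxx; case: eqP => //; lia.
have {}n1 : (x != i.-1 :> nat).
  by apply/eqP => e; apply: n1; apply: val_inj; rewrite [LHS]e -ej.
rewrite (negbTE n1); case: eqVneq => [-> /= | /eqP n2]; first by rewrite ej eqxx.
by case: eqP => // e; case: n2; apply: val_inj; rewrite [LHS]e -ej.
Qed.

Lemma sT_sq i : (sT i * sT i = 1)%g.
Proof. by rewrite /sT; case: insubP => *; rewrite ?tperm2 ?mulg1. Qed.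

Lemma sT_braid i : (0 < i)%N -> (i.+1 < n)%N ->
  (sT i * sT i.+1 * sT i = sT i.+1 * sT i * sT i.+1)%g.
Proof.
move=> i0 iN; apply/permP => x; apply/val_inj; rewrite !permM.
rewrite !sT_val /=; try lia.
by do !case: eqP => //=; lia.
Qed.

Lemma sT_comm i j : (0 < i)%N -> (i.+1 < j)%N -> (j < n)%N ->
  (sT i * sT j = sT j * sT i)%g.
Proof.
move=> i0 ij jN; apply/permP => x; apply/val_inj; rewrite !permM.
rewrite !sT_val /=; try lia.
by do !case: eqP => //=; lia.
Qed.

Local Notation sprodn := (wprod (@mulg _) sT).

Lemma sprod_wprod (r : seq (gidx n)) : sprod r = sprodn (map val r).
Proof.
rewrite /sprod /wprod big_map; apply: eq_bigr => i _.
by rewrite /sT insubT ?(valP i) // => h; congr stransp; apply/val_inj.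
Qed.

Lemma sprod_block k a (x : 'I_n) : (k < n)%N -> (a <= k)%N -> x = k :> nat ->
  sprodn (block k a) x = (k - a)%N :> nat.
Proof.
move=> kn; elim: a => [|a IH] ak xk; first by rewrite /wprod big_nil perm1 xk subn0.
rewrite blockS wprod_rcons permM -[LHS]/(val _) sT_val; last by lia.
by rewrite IH ?eqxx //; lia.
Qed.

Lemma sprod_fix r (x : 'I_n) : (forall i, i \in r -> (0 < i <= n.-1)%N && (i < x)%N) ->
  sprodn r x = x.
Proof.
elim/last_ind: r => [|r i IH] rx; first by rewrite /wprod big_nil perm1.
rewrite wprod_rcons permM IH => [|j jr]; last by apply: rx; rewrite mem_rcons inE jr orbT.
have ix := rx i; rewrite mem_rcons mem_head in ix; have {ix} := ix isT => ix.
by apply: val_inj; rewrite sT_val; [do !case: eqP => //=; lia | lia].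
Qed.

(** The letters before the top block fix the highest point involved, and the block sends it down by
    its length; so the permutation determines the top digit, and induction gives the rest. *)
Lemma sprod_cword_inj c c' : (size c < n)%N -> size c = size c' -> vcode c -> vcode c' ->
  sprodn (cword c) = sprodn (cword c') -> c = c'.
Proof.
elim: c c' => [|a c IH] [|a' c'] //= cn [ec] /andP[ac vc] /andP[ac' vc'].
rewrite -ec in ac' *; rewrite !wprod_cat => e.
have cfix c1 : size c1 = size c -> vcode c1 -> sprodn (cword c1) (Ordinal cn) = Ordinal cn.
  move=> s1 v1; apply: sprod_fix => i /(cword_range v1); rewrite s1 /=; lia.
have := congr1 (fun s : 'S_n => val (s (Ordinal cn))) e.
rewrite /= !permM !cfix // !sprod_block // => aa'.
have {aa'} aa' : a = a' by lia.
move: e; rewrite -aa' => /mulIg e1; by rewrite (IH c' (ltnW cn) ec vc vc' e1).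
Qed.
End StransWords.

Section HeckeSpan.
Variables (K : fieldType) (q : K) (n : nat).
Hypothesis n0 : (0 < n)%N.
Local Notation H := (hecke q n).
Local Notation hT := (hT q n).

Lemma hT_val (i : gidx n) : hT (val i) = pgen (@hecke_rel K q n) i.
Proof.
rewrite /hT insubT ?(valP i) // => h.
by congr pgen; apply: val_inj.
Qed.

Lemma hecke_gens_hT : hecke_gens q n hT.
Proof.
split=> [i i0 iN | i j i0 ij jN | i iN].
- have iP : (0 < i < n)%N by lia.
  have jP : (0 < i.+1 < n)%N by lia.
  rewrite (hT_val (exist _ i iP)) (hT_val (exist _ i.+1 jP)) -!mulrA.
  have := pres_eq (pcong_rel (@hecke_braid K q n (exist _ i iP) (exist _ i.+1 jP) erefl)).
  by rewrite -!pmul_pi.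
- have iP : (0 < i < n)%N by lia.
  have jP : (0 < j < n)%N by lia.
  rewrite (hT_val (exist _ i iP)) (hT_val (exist _ j jP)).
  have h : ((i.+1 < j) || (j.+1 < i))%N by rewrite ij.
  have := pres_eq (pcong_rel (@hecke_comm K q n (exist _ i iP) (exist _ j jP) h)).
  by rewrite -!pmul_pi.
rewrite (hT_val (exist _ i iN)).
have := pres_eq (pcong_rel (@hecke_quad K q n (exist _ i iN))).
by rewrite -padd_pi -!pmul_pi.
Qed.

Local Notation hprod := (wprod (@GRing.mul H) hT).
Local Notation sprodn := (wprod (@mulg _) (@sT n)).

Definition code (c : seq nat) : bool := vcode c && (size c == n.-1).

Lemma code_range c i : code c -> (0 < i < n)%N = (0 < i <= size c)%N.
Proof. by case/andP => _ /eqP ->; lia. Qed.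

Lemma hprod_cstep c i c' : code c -> (0 < i < n)%N -> cstep c i = Some c' ->
  hprod (cword c) * hT i = hprod (cword c').
Proof.
case: hecke_gens_hT => br co _ cc iN E.
have sc : (size c < n)%N by case/andP: cc => _ /eqP ->; lia.
apply: (wprod_cstep br co sc _ _ E); first by case/andP: cc.
by rewrite -code_range.
Qed.

Lemma sprod_cstep c i c' : code c -> (0 < i < n)%N -> cstep c i = Some c' ->
  (sprodn (cword c) * sT n i)%g = sprodn (cword c').
Proof.
move=> cc iN E.
have sc : (size c < n)%N by case/andP: cc => _ /eqP ->; lia.
apply: (wprod_cstep _ _ sc _ _ E); [exact: sT_braid|exact: sT_comm|by case/andP: cc|].
by rewrite -code_range.
Qed.

Lemma hprod_rcons r i : hprod (rcons r i) = hprod r * hT i.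
Proof. exact: wprod_rcons. Qed.

Lemma sprod_rcons r i : sprodn (rcons r i) = (sprodn r * sT n i)%g.
Proof. exact: wprod_rcons. Qed.

Definition code0 : seq nat := nseq n.-1 0%N.

Lemma code_code0 : code code0 /\ cword code0 = [::].
Proof.
rewrite /code /code0 size_nseq eqxx andbT.
by elim: (n.-1) => //= m [-> ->].
Qed.

(** The Hecke products are compared only when no letter is lost: a cancellation s_i s_i = 1 of
    permutations has no counterpart for T_i. *)
Lemma word_code (r : seq nat) : (forall i, i \in r -> (0 < i < n)%N) ->
  exists c, [/\ code c, sprodn r = sprodn (cword c), (size (cword c) <= size r)%N
    & size (cword c) = size r -> hprod r = hprod (cword c)].
Proof.
elim/last_ind: r => [|r i IH] rn.
  by have [c0 w0] := code_code0; exists code0; rewrite w0.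
have [|c [cc sc zc hc]] := IH; first by move=> j jr; apply: rn; rewrite mem_rcons inE jr orbT.
have iN : (0 < i < n)%N by apply: rn; rewrite mem_rcons mem_head.
have [vc /eqP nc] := andP cc; have ic : (0 < i <= size c)%N by rewrite -code_range.
case E: (cstep c i) => [c'|].
  have [v' s' z'] := cstep_some vc ic E.
  exists c'; rewrite /code v' s' nc eqxx hprod_rcons sprod_rcons z' size_rcons !ltnS zc sc.
  by rewrite (sprod_cstep cc iN E); split=> // -[/hc ->]; apply: hprod_cstep.
have [c' [v' s' E']] := cstep_none vc ic E.
have cc' : code c' by rewrite /code v' s' nc eqxx.
have ic' : (0 < i <= size c')%N by rewrite s'.
have [_ _ z'] := cstep_some v' ic' E'.
exists c'; rewrite hprod_rcons sprod_rcons size_rcons; split=> //; last by lia.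
  by rewrite sc -(sprod_cstep cc' iN E') -mulgA sT_sq mulg1.
by lia.
Qed.

Lemma gidx_word (r : seq nat) : (forall i, i \in r -> (0 < i < n)%N) ->
  exists r' : seq (gidx n), map val r' = r.
Proof.
elim: r => [|i r IH] rn; first by exists [::].
have [|r' er] := IH; first by move=> j jr; apply: rn; rewrite inE jr orbT.
by exists ((exist _ i (rn i (mem_head _ _)) : gidx n) :: r'); rewrite /= er.
Qed.

Lemma cword_lt c i : code c -> i \in cword c -> (0 < i < n)%N.
Proof. by move=> cc ic; rewrite (code_range _ cc); apply: cword_range ic; case/andP: cc. Qed.

(** Takes the place of Matsumoto's theorem: a reduced word loses no letter in the passage to its
    normal form, so its Hecke product is that of the normal form. *)
Lemma reduced_code w r : reduced_word w r ->
  exists c, [/\ code c, sprodn (cword c) = w, size (cword c) = size r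
    & \prod_(i <- r) pgen (@hecke_rel K q n) i = hprod (cword c)].
Proof.
move=> [rw rmin].
have [|c [cc sc zc hc]] := @word_code (map val r).
  by move=> i /mapP[j _ ->]; exact: valP j.
have [r' er'] := gidx_word (fun i => @cword_lt c i cc).
have z : size (cword c) = size r.
  apply/eqP; rewrite eqn_leq -{1}(size_map val r) zc /= -er' size_map.
  by apply: rmin; rewrite sprod_wprod er' -sc -sprod_wprod.
exists c; split=> //; first by rewrite -sc -sprod_wprod.
rewrite -hc ?size_map // /wprod big_map; apply: eq_bigr => i _.
by rewrite hT_val.
Qed.

Lemma hTw_code w : exists c,
  [/\ code c, hTw q w = hprod (cword c) & size (cword c) = perm_length w].
Proof.
rewrite /hTw /perm_length /reduced; case: classical_sets.xgetP => [r _ rw | _].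
  by have [c [cc _ zc hc]] := reduced_code rw; exists c.
(* The default of [reduced] is the empty word, which is coded as well. *)
have [c0 w0] := code_code0; exists code0; rewrite w0; split=> //.
by rewrite /wprod !big_nil.
Qed.

Lemma hTw_sprod c : code c -> hTw q (sprodn (cword c)) = hprod (cword c) /\
  perm_length (sprodn (cword c)) = size (cword c).
Proof.
move=> cc; set w := sprodn _.
have [r' er'] := gidx_word (fun i => @cword_lt c i cc).
have ex : exists m, `[< exists2 r : seq (gidx n), sprod r = w & size r = m >].
  by exists (size r'); apply/asboolP; exists r'; rewrite // sprod_wprod er'.
have [r rw rmin] : exists2 r : seq (gidx n), sprod r = w & reduced_word w r.
  case: (ex_minnP ex) => m /asboolP[r rw rm] mmin; exists r => //; split=> // r1 r1w.
  by rewrite rm mmin //; apply/asboolP; exists r1.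
rewrite /hTw /perm_length /reduced; case: classical_sets.xgetP => [r1 _ r1w | /(_ r) []//].
have [c1 [cc1 sc1 zc1 hc1]] := reduced_code r1w.
have e : c1 = c.
  have [v1 /eqP s1] := andP cc1; have [v /eqP s] := andP cc.
  by apply: (@sprod_cword_inj n) => //; rewrite ?s1 ?s //; lia.
by rewrite hc1 -zc1 e.
Qed.

Local Notation hpi := (generic_quotient.pi (presented (@hecke_rel K q n))).

Lemma hTw_span (x : H) : exists b : 'S_n -> K, x = \sum_w b w *: hTw q w.
Proof.
pose P (x : H) := exists b : 'S_n -> K, x = \sum_w b w *: hTw q w.
have PD y z : P y -> P z -> P (y + z).
  move=> [b ->] [b' ->]; exists (fun w => b w + b' w).
  by rewrite -big_split; apply: eq_bigr => w _; rewrite scalerDl.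
have PZ (a : K) y : P y -> P (a *: y).
  move=> [b ->]; exists (fun w => a * b w).
  by rewrite scaler_sumr; apply: eq_bigr => w _; rewrite scalerA.
have P0 : P 0 by exists (fun=> 0); rewrite big1 // => w _; rewrite scale0r.
have Pw w : P (hTw q w).
  exists (fun w' => (w' == w)%:R); rewrite (bigD1 w) //= eqxx scale1r.
  by rewrite big1 ?addr0 // => w' /negbTE ->; rewrite scale0r.
have Pc c : code c -> P (hprod (cword c)) by move=> /hTw_sprod[<- _].
have PT y i : P y -> (0 < i < n)%N -> P (y * hT i).
  move=> [b ->] iN; rewrite mulr_suml; apply: big_ind => // w _.
  rewrite -scalerAl; apply: (PZ); have [c [cc -> _]] := hTw_code w.
  have [vc /eqP nc] := andP cc; have ic : (0 < i <= size c)%N by rewrite -code_range.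
  case E: (cstep c i) => [c'|].
    have [v' s' z'] := cstep_some vc ic E.
    by rewrite (hprod_cstep cc iN E); apply: (Pc); rewrite /code v' s' nc eqxx.
  have [c' [v' s' E']] := cstep_none vc ic E.
  have cc' : code c' by rewrite /code v' s' nc eqxx.
  (* The word of c is that of c' followed by i, so T_i^2 appears and the quadratic relation yields
     the words of c' and c. *)
  rewrite -(hprod_cstep cc' iN E') -mulrA (gquad hecke_gens_hT) // mulrDr mulr1 -scalerAr.
  by rewrite (hprod_cstep cc' iN E'); apply: (PD); [|apply: (PZ)]; apply: (Pc).
have P1 : P 1.
  have [c0 w0] := code_code0; have := Pc _ c0.
  by rewrite w0 /wprod big_nil.
suff Pm (t : pterm K (gidx n)) y : P y -> P (y * hpi t).
  rewrite -[x]mul1r; elim/generic_quotient.quotW: x => t; exact: Pm.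
elim: t y => [i | a | t1 IH1 t2 IH2 | t1 IH1 t2 IH2] y Py.
- by rewrite -[X in _ * X]/(pgen (@hecke_rel K q n) i) -hT_val; apply: (PT) => //; apply: valP i.
- have -> : hpi (Scal a) = a%:A :> H.
    by rewrite -[RHS]/(pmul (pscal _ a) (1 : H))
      -[RHS]/((pscal (@hecke_rel K q n) a : H) * 1) mulr1.
  by rewrite mulr_algr; apply: (PZ).
- have -> : hpi (Add t1 t2) = hpi t1 + hpi t2 :> H by rewrite -padd_pi.
  by rewrite mulrDr; apply: (PD); [apply: IH1|apply: IH2].
have -> : hpi (Mul t1 t2) = hpi t1 * hpi t2 :> H by rewrite -pmul_pi.
by rewrite mulrA; apply: IH2; apply: IH1.
Qed.

Fixpoint fullcode (m : nat) : seq nat := if m is m'.+1 then m :: fullcode m' else [::].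

Lemma size_fullcode m : size (fullcode m) = m. Proof. by elim: m => //= m ->. Qed.

Lemma vcode_fullcode m : vcode (fullcode m).
Proof. by elim: m => //= m ->; rewrite size_fullcode leqnn. Qed.

Lemma fullcode_max c : vcode c -> (size (cword c) <= size (cword (fullcode (size c))))%N /\
  (size (cword c) = size (cword (fullcode (size c))) -> c = fullcode (size c)).
Proof.
elim: c => //= a c IH /andP[ac /IH[h1 h2]].
rewrite !size_cat !size_block; split=> [|e]; first by lia.
by rewrite -h2; [congr cons|]; lia.
Qed.

Lemma hprod_block m : hprod (block m m) = gdown hT m.
Proof.
elim: m => [|m IH]; first by rewrite /wprod big_nil.
have -> : block m.+1 m.+1 = m.+1 :: block m m.
  rewrite /block /= subn0 -[1%N]/(1 + 0)%N iotaDl -map_comp.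
  by congr cons; apply: eq_map => i /=; rewrite subSS.
by rewrite /wprod big_cons -/(wprod _ _ _) IH.
Qed.

Lemma hprod_fullcode m : hprod (cword (fullcode m)) = glong hT m.+1.
Proof.
elim: m => [|m IH]; first by rewrite /= mulr1 /wprod big_nil.
by rewrite /= size_fullcode wprod_cat IH hprod_block.
Qed.

(** [wlongest] is any permutation of maximal length; by [fullcode_max] the only code with that many
    letters is the one with maximal digits. *)
Lemma hTw_longest : hTw q (wlongest n) = glong hT n.
Proof.
have [c [cc -> zc]] := hTw_code (wlongest n).
have [vc /eqP nc] := andP cc.
have [m1 m2] := fullcode_max vc.
have cf : code (fullcode (size c)) by rewrite /code vcode_fullcode size_fullcode nc eqxx.
have [_ lf] := hTw_sprod cf.
have h : (perm_length (sprodn (cword (fullcode (size c)))) <= perm_length (wlongest n))%N.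
  by rewrite /wlongest; case: arg_maxnP => // w _; apply.
rewrite lf -zc in h; rewrite m2 ?nc ?hprod_fullcode ?prednK //.
by rewrite -nc; apply/eqP; rewrite eqn_leq m1 h.
Qed.
End HeckeSpan.

(** * Evaluation of rational functions *)

Section RatEval.
Variables (K : fieldType) (n : nat) (k : 'I_n) (s : K).
Local Notation P := {mpoly K[n]}.
Local Notation fr := (@tofrac P).

(* [rat_eval] with a denominator that does not vanish at the point; unlike the
   non-divisibility it is visibly stable under products. *)
Definition reval (a b : ratfun K n) : Prop := exists p d : P,
  [/\ psubst k s d != 0, a = fr p / fr d & b = fr (psubst k s p) / fr (psubst k s d)].

Lemma psubstC c : psubst k s c%:MP = c%:MP.
Proof. exact: comp_mpolyC. Qed.

Lemma psubstX i : psubst k s 'X_i = if i == k then s%:MP else 'X_i.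
Proof. by rewrite /psubst comp_mpolyXU -tnth_nth tnth_mktuple. Qed.

Lemma psubstD p r : psubst k s (p + r) = psubst k s p + psubst k s r.
Proof. exact: rmorphD. Qed.

Lemma psubstM p r : psubst k s (p * r) = psubst k s p * psubst k s r.
Proof. exact: rmorphM. Qed.

Lemma psubst_neq0 d : psubst k s d != 0 -> d != 0.
Proof. by apply: contra => /eqP ->; rewrite /psubst comp_mpoly0. Qed.

Lemma reval_rat_eval a b : reval a b -> rat_eval k s a b.
Proof.
case=> p [d [d0 -> ->]]; exists p, d; split=> // -[e de].
by move: d0; rewrite de psubstM /psubst comp_mpolyB -!/(psubst k s _) psubstX psubstC
  eqxx subrr mulr0 eqxx.
Qed.

Lemma reval_frac p : reval (fr p) (fr (psubst k s p)).
Proof.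
have e1 : psubst k s 1 = 1 by apply: rmorph1.
by exists p, 1; rewrite e1 oner_eq0 !tofrac1 !divr1.
Qed.

Lemma reval_const c : reval (ratconst K n c) (ratconst K n c).
Proof. by have := reval_frac c%:MP; rewrite psubstC. Qed.

Lemma revalD a b a' b' : reval a b -> reval a' b' -> reval (a + a') (b + b').
Proof.
case=> p [d [d0 -> ->]] [p' [d' [d'0 -> ->]]].
have dn := psubst_neq0 d0; have d'n := psubst_neq0 d'0.
exists (p * d' + p' * d), (d * d'); rewrite psubstD !psubstM mulf_neq0 //; split=> //.
  by rewrite addf_div ?tofrac_eq0 // tofracD !tofracM.
by rewrite addf_div ?tofrac_eq0 // tofracD !tofracM.
Qed.

Lemma revalM a b a' b' : reval a b -> reval a' b' -> reval (a * a') (b * b').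
Proof.
case=> p [d [d0 -> ->]] [p' [d' [d'0 -> ->]]].
exists (p * p'), (d * d'); rewrite !psubstM mulf_neq0 //; split=> //.
  by rewrite mulf_div !tofracM.
by rewrite mulf_div !tofracM.
Qed.

Lemma revalN a b : reval a b -> reval (- a) (- b).
Proof.
by move=> ab; have := revalM (reval_const (-1)) ab; rewrite rmorphN1 !mulN1r.
Qed.

Lemma revalB a b a' b' : reval a b -> reval a' b' -> reval (a - a') (b - b').
Proof. by move=> h h'; apply: revalD => //; apply: revalN. Qed.

Lemma revalV a b : b != 0 -> reval a b -> reval a^-1 b^-1.
Proof.
move=> b0 [p [d [d0 -> be]]]; exists d, p; rewrite be !invf_div; split=> //.
by apply: contra b0 => /eqP p0; rewrite be p0 tofrac0 mul0r.
Qed.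

Lemma reval_prod (I : eqType) (r : seq I) (f g : I -> ratfun K n) :
  (forall i, i \in r -> reval (f i) (g i)) ->
  reval (\prod_(i <- r) f i) (\prod_(i <- r) g i).
Proof.
elim: r => [|i r IH] fg.
  by rewrite !big_nil -(rmorph1 (ratconst K n)); apply: reval_const.
rewrite !big_cons; apply: revalM; first by apply: fg; rewrite mem_head.
by apply: IH => j jr; apply: fg; rewrite inE jr orbT.
Qed.
End RatEval.

Lemma uvarE (K : fieldType) n (i : 'I_n) : uvar K n i.+1 = @tofrac {mpoly K[n]} 'X_i.
Proof. by rewrite /uvar /= valK. Qed.

Lemma uvar_neq_const (K : fieldType) n (i : 'I_n) c : uvar K n i.+1 != ratconst K n c.
Proof.
rewrite uvarE tofrac_eq; apply/eqP => e.
have := congr1 (fun p : {mpoly K[n]} => msize p) e.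
by rewrite msizeX mdeg1 msizeC; case: (c != 0).
Qed.

Lemma uvar_inj (K : fieldType) n (i j : 'I_n) : i != j -> uvar K n i.+1 != uvar K n j.+1.
Proof.
move=> ij; rewrite !uvarE tofrac_eq; apply/eqP => e.
have := congr1 (meval (fun l => (l == i)%:R)) e.
by rewrite !mevalXU eqxx eq_sym (negbTE ij) => /eqP; rewrite oner_eq0.
Qed.

(** * Hecke algebra valued rational functions *)

Section HeckeFunctions.
Variables (K : fieldType) (q : K) (n : nat).
Local Notation H := (hecke q n).
Local Notation R := (ratfun K n).

(* The one-dimensional representation used in [hecke_nontrivial]. *)
Lemma hecke_character : exists chi : H -> K, [/\ chi 1 = 1,
  {morph chi : x y / x + y}, {morph chi : x y / x * y}
  & forall c x, chi (c *: x) = c * chi x].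
Proof.
pose g (_ : gidx n) : K^o := if q == 0 then 1 else q.
have grel x y : hecke_rel q x y -> pinterp g x = pinterp g y.
  case=> [i j _|i j _|i] //=; rewrite /g; case: eqP => [->|/eqP q0].
    by rewrite invr0 subrr scale0r mul0r addr0 scale1r mulr1.
  rewrite scale1r mulr_algl [X in _ = _ + X]mulrBl -[X in _ = X + _]mulr1.
  by rewrite mulVf // addrC mulr1 subrK.
by have [_ l1 lD lM lZ] := plift_spec grel; exists (plift g).
Qed.

(** The character of the Hecke algebra, extended to the rational functions, sends 1 to 1; this is
    what the algebra structure on [hfun] requires. *)
Lemma hfun_nontrivial : (1 : hfun q n) != 0.
Proof.
have [chi [c1 cD cM cZ]] := hecke_character.
pose g (x : H) : R^o := ratconst K n (chi x).
have grel x y : tens_rel (ratconst K n) x y -> pinterp g x = pinterp g y.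
  case=> [a b | a b | c a | ] /=; rewrite /g.
  - by rewrite cD rmorphD.
  - by rewrite cM rmorphM.
  - by rewrite cZ rmorphM mulr_algl.
  by rewrite c1 rmorph1 scale1r.
have [_ l1 _ _ lZ] := plift_spec grel.
apply/eqP => e; have := oner_neq0 R; rewrite -[1]/(1 : R^o) -l1 e.
by rewrite -(scale0r (0 : hfun q n)) lZ scale0r eqxx.
Qed.

HB.instance Definition _ :=
  GRing.PzSemiRing_isNonZero.Build (hfun q n) hfun_nontrivial.
HB.instance Definition _ :=
  GRing.Lmodule_isLalgebra.Build R (hfun q n)
    (@pscaleAl _ _ (@tens_rel _ _ (ratconst K n) H)).
HB.instance Definition _ :=
  GRing.Lalgebra_isAlgebra.Build R (hfun q n)
    (@pscaleAr _ _ (@tens_rel _ _ (ratconst K n) H)).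

Definition ten (x : H) : hfun q n := tens1 (ratconst K n) x.

Lemma tenD x y : ten (x + y) = ten x + ten y.
Proof.
have := pres_eq (pcong_rel (tens_add (ratconst K n) x y)).
by rewrite -padd_pi.
Qed.

Lemma tenM x y : ten (x * y) = ten x * ten y.
Proof.
have := pres_eq (pcong_rel (tens_mul (ratconst K n) x y)).
by rewrite -pmul_pi.
Qed.

Lemma tenZ c x : ten (c *: x) = ratconst K n c *: ten x.
Proof.
have := pres_eq (pcong_rel (tens_scal (ratconst K n) c x)).
by rewrite -pmul_pi.
Qed.

Lemma ten1 : ten 1 = 1.
Proof. exact: (pres_eq (pcong_rel (tens_one (ratconst K n) H))). Qed.

Lemma tenB x y : ten (x - y) = ten x - ten y.
Proof. by rewrite -scaleN1r tenD tenZ rmorphN1 scaleN1r. Qed.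

Lemma ten0 : ten 0 = 0.
Proof. by rewrite -(scale0r 0) tenZ rmorph0 scale0r. Qed.

Lemma ten_sum (I : Type) (r : seq I) (f : I -> H) :
  ten (\sum_(i <- r) f i) = \sum_(i <- r) ten (f i).
Proof. by apply: (big_morph ten tenD ten0). Qed.

Variables (k : 'I_n) (s : K).

(** A relation on arbitrary expansions rather than on coordinates, so that it is stable under
    products without structure constants; [heval_hfun_eval] expands the elements x in the T_w at the
    end. *)
Inductive heval : hfun q n -> hfun q n -> Prop :=
| heval_scale a b x of reval k s a b : heval (a *: ten x) (b *: ten x)
| heval_add f g f' g' of heval f g & heval f' g' : heval (f + f') (g + g').

Lemma heval_ten x : heval (ten x) (ten x).
Proof.
rewrite -[ten x]scale1r -(rmorph1 (ratconst K n)).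
by apply: heval_scale; apply: reval_const.
Qed.

Lemma hevalM f g f' g' : heval f g -> heval f' g' -> heval (f * f') (g * g').
Proof.
move=> fg f'g'; elim: fg => {f g} [a b x ab | f1 g1 f2 g2 _ h1 _ h2]; last first.
  by rewrite !mulrDl; apply: heval_add.
elim: f'g' => {f' g'} [a' b' x' ab' | f1 g1 f2 g2 _ h1 _ h2]; last first.
  by rewrite !mulrDr; apply: heval_add.
rewrite -!scalerAl -!scalerAr !scalerA -tenM.
by apply: heval_scale; apply: revalM.
Qed.

Lemma hevalZ a b f g : reval k s a b -> heval f g -> heval (a *: f) (b *: g).
Proof.
move=> ab fg; have := hevalM (heval_scale 1 ab) fg.
by rewrite ten1 !mulr_algl.
Qed.

Lemma heval_sum (I : eqType) (r : seq I) (f g : I -> hfun q n) :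
  (forall i, i \in r -> heval (f i) (g i)) ->
  heval (\sum_(i <- r) f i) (\sum_(i <- r) g i).
Proof.
elim: r => [|i r IH] fg; first by rewrite !big_nil -ten0; apply: heval_ten.
rewrite !big_cons; apply: heval_add; first by apply: fg; rewrite mem_head.
by apply: IH => j jr; apply: fg; rewrite inE jr orbT.
Qed.

Lemma heval_prod (I : eqType) (r : seq I) (f g : I -> hfun q n) :
  (forall i, i \in r -> heval (f i) (g i)) ->
  heval (\prod_(i <- r) f i) (\prod_(i <- r) g i).
Proof.
elim: r => [|i r IH] fg; first by rewrite !big_nil -ten1; apply: heval_ten.
rewrite !big_cons; apply: hevalM; first by apply: fg; rewrite mem_head.
by apply: IH => j jr; apply: fg; rewrite inE jr orbT.
Qed.

Lemma heval_hfun_eval f g : (0 < n)%N -> heval f g -> hfun_eval k s f g.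
Proof.
move=> n0 fg; suff [a [b [-> -> ab]]] : exists a b : 'S_n -> R,
    [/\ f = \sum_w a w *: ten (hTw q w), g = \sum_w b w *: ten (hTw q w)
      & forall w, reval k s (a w) (b w)].
  by exists a, b; split=> // w; apply: reval_rat_eval.
elim: fg => {f g} [a b x ab | f g f' g' _ [a [b [-> -> ab]]] _ [a' [b' [-> -> ab']]]].
  have [c ->] := hTw_span n0 x.
  exists (fun w => a * ratconst K n (c w)), (fun w => b * ratconst K n (c w)); split.
  - by rewrite ten_sum scaler_sumr; apply: eq_bigr => w _; rewrite tenZ scalerA.
  - by rewrite ten_sum scaler_sumr; apply: eq_bigr => w _; rewrite tenZ scalerA.
  by move=> w; apply: revalM => //; apply: reval_const.
exists (fun w => a w + a' w), (fun w => b w + b' w); split.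
- by rewrite -big_split; apply: eq_bigr => w _; rewrite scalerDl.
- by rewrite -big_split; apply: eq_bigr => w _; rewrite scalerDl.
by move=> w; apply: revalD.
Qed.
End HeckeFunctions.

(** * Hook lengths *)

Definition rowlen (D : seq cell) (i : nat) : nat := count (fun c => c.1 == i) D.
Definition collen (D : seq cell) (j : nat) : nat := count (fun c => c.2 == j) D.

Definition hookD (D : seq cell) (c : cell) : nat :=
  (rowlen D c.1 + collen D c.2 + 1 - (c.1 + c.2))%N.

(** Columns and rows are initial segments, so membership becomes a numeric inequality in either of
    two ways, which [lia] can combine. *)
Lemma std_mem r : std r ->
  (forall a b, ((a, b) \in r) = (0 < a <= collen r b)%N && (0 < b)%N) /\
  (forall a b, ((a, b) \in r) = (0 < b <= rowlen r a)%N && (0 < a)%N).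
Proof.
elim: r => [_ | [i j] r IH [[cr dc] /IH[hc hr]]].
  by split=> a b; rewrite in_nil /=; lia.
have [i0 j0 ni nj] := dc _ _ (mem_head _ _).
have ei : i = (collen r j).+1.
  have := cr; rewrite hc i0 j0 andbT -ltnNge => h1.
  case: (ltnP 1 i) => [/ni | ]; last by lia.
  by rewrite inE xpair_eqE hc; lia.
have ej : j = (rowlen r i).+1.
  have := cr; rewrite hr i0 j0 andbT -ltnNge => h1.
  case: (ltnP 1 j) => [/nj | ]; last by lia.
  by rewrite inE xpair_eqE hr; lia.
split=> a b; rewrite inE xpair_eqE.
  rewrite hc /collen /= -/(collen r b); case: (eqVneq j b) => [eb | nb].
    by rewrite -eb andbT [X in a == X]ei; lia.
  by rewrite andbF.
rewrite hr /rowlen /= -/(rowlen r a); case: (eqVneq i a) => // ea.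
by rewrite -ea /= [X in b == X]ej; lia.
Qed.

Lemma std_head_lens i j r : std ((i, j) :: r) ->
  [/\ (0 < i)%N, (0 < j)%N, i = (collen r j).+1 & j = (rowlen r i).+1].
Proof.
move=> sr; have [[cr dc] sr'] := sr; have [hc hr] := std_mem sr'.
have [i0 j0 ni nj] := dc _ _ (mem_head _ _); split=> //.
  have := cr; rewrite hc i0 j0 andbT -ltnNge => h1.
  case: (ltnP 1 i) => [/ni | ]; last by lia.
  by rewrite inE xpair_eqE hc; lia.
have := cr; rewrite hr i0 j0 andbT -ltnNge => h1.
case: (ltnP 1 j) => [/nj | ]; last by lia.
by rewrite inE xpair_eqE hr; lia.
Qed.

(** * Telescoping of content factors over columns and rows *)

Section Telescope.
Variables (F : fieldType) (G : int -> F).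
Hypothesis G0 : forall d, G d != 0.

(** For G d = u - q^(2d) this is the factor of [gc] at a cell of content d. *)
Definition cellfac (d : int) : F := G (d + 1) * G (d - 1) / G d ^+ 2.

Lemma iotaSr m l : iota m l.+1 = iota m l ++ [:: (m + l)%N].
Proof. by rewrite -addn1 iotaD. Qed.

Lemma telescope_down (b : int) l :
  \prod_(a <- iota 1 l) cellfac (b - a%:Z) =
  G b / G (b - l%:Z) * (G (b - l%:Z - 1) / G (b - 1)).
Proof.
elim: l => [|l IH].
  by rewrite big_nil subr0 !divff // mulr1.
rewrite iotaSr big_cat /= big_seq1 IH /cellfac.
have -> : b - (1 + l)%N%:Z + 1 = b - l%:Z by lia.
have -> : b - l%:Z - 1 = b - (1 + l)%N%:Z by lia.
have -> : (l.+1 = 1 + l)%N by [].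
by field; rewrite !G0.
Qed.

Lemma telescope_up (x a : int) l :
  \prod_(b <- iota 0 l) cellfac (x + b%:Z - a) =
  G (x + l%:Z - a) / G (x - a) * (G (x - a - 1) / G (x + l%:Z - a - 1)).
Proof.
elim: l => [|l IH].
  by rewrite big_nil addr0 !divff // mulr1.
rewrite iotaSr big_cat /= big_seq1 IH /cellfac add0n.
have -> : x + l%:Z - a + 1 = x + l.+1%:Z - a by lia.
have -> : x + l.+1%:Z - a - 1 = x + l%:Z - a by lia.
by field; rewrite !G0.
Qed.

Lemma telescope1 (f : nat -> F) m : (forall i, f i != 0) ->
  \prod_(b <- iota 1 m) (f b / f b.-1) = f m / f 0%N.
Proof.
move=> f0; elim: m => [|m IH]; first by rewrite big_nil divff.
rewrite iotaSr big_cat /= big_seq1 IH add1n /=.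
by field; rewrite !f0.
Qed.

(** Cuts the diagram along the column of the new cell: whole columns to its left, and the ends of
    the rows above it from column j on. Along each piece the contents are consecutive. *)
Lemma std_perm i j r : std ((i, j) :: r) ->
  perm_eq r ([seq (a, b) | b <- iota 1 j.-1, a <- iota 1 (collen r b)] ++
             [seq (a, b) | a <- iota 1 i.-1, b <- iota j ((rowlen r a).+1 - j)]).
Proof.
move=> sr; have [i0 j0 ei ej] := std_head_lens sr.
have [[cr dc] sr'] := sr; have [hc hr] := std_mem sr'.
apply: uniq_perm; first exact: std_uniq.
  rewrite cat_uniq; apply/and3P; split.
  - apply: allpairs_uniq_dep => [|b _|]; rewrite ?iota_uniq //.
    by move=> [b a] [b' a'] _ _ /= [-> ->].
  - apply/hasPn => -[a b] /allpairsPdep[a1 [b1 [_]]]; rewrite mem_iota => hb [ea eb].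
    apply/negP => /allpairsPdep[b2 [a2 []]]; rewrite mem_iota => hb2 _ [_ eb2].
    by subst; lia.
  apply: allpairs_uniq_dep => [|b _|]; rewrite ?iota_uniq //.
  by move=> [b a] [b' a'] _ _ /= [-> ->].
move=> [a b]; rewrite mem_cat; apply/idP/orP => [abr | ].
  have [h1 h2] := (abr, abr); rewrite hc in h1; rewrite hr in h2.
  case: (ltnP b j) => bj.
    left; apply/allpairsPdep; exists b, a; rewrite !mem_iota; split=> //; lia.
  right; apply/allpairsPdep; exists a, b; rewrite !mem_iota; split=> //; last by lia.
  apply/andP; split; first by lia.
  have : ~ (i <= a)%N; last by lia.
  move=> ia; move: cr; rewrite (downset_le (std_downset sr') abr) //; lia.
case=> /allpairsPdep[x [y []]]; rewrite !mem_iota => hx hy [-> ->].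
  by rewrite hc; lia.
by rewrite hr; lia.
Qed.

(** The upper ends of the columns and the left ends of the row pieces telescope a second time,
    leaving G at the new content over G 0, where G 0 is the factor u - 1 of [gwt_fusion]; the free
    ends remain as the two products. *)
Lemma cellfac_prod i j r : std ((i, j) :: r) ->
  G 0 * \prod_(c <- r) cellfac (content c) =
  G (content (i, j)) *
  (\prod_(b <- iota 1 j.-1) (G (b%:Z - (collen r b)%:Z - 1) / G (b%:Z - (collen r b)%:Z)) *
   \prod_(a <- iota 1 i.-1) (G ((rowlen r a)%:Z - a%:Z + 1) / G ((rowlen r a)%:Z - a%:Z))).
Proof.
move=> sr; have [i0 j0 ei ej] := std_head_lens sr.
have [[cr dc] sr'] := sr; have [hc hr] := std_mem sr'.
rewrite (perm_big _ (std_perm sr)) big_cat /= !big_allpairs_dep /=.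
have -> : \prod_(b <- iota 1 j.-1) \prod_(a <- iota 1 (collen r b)) cellfac (content (a, b)) =
    \prod_(b <- iota 1 j.-1) (G b%:Z / G (b.-1)%:Z) *
    \prod_(b <- iota 1 j.-1) (G (b%:Z - (collen r b)%:Z - 1) / G (b%:Z - (collen r b)%:Z)).
  rewrite -big_split; apply: eq_big_seq => b; rewrite mem_iota => hb.
  rewrite /content /= telescope_down.
  have -> : (b.-1)%:Z = b%:Z - 1 by lia.
  by field; rewrite !G0.
have -> : \prod_(a <- iota 1 i.-1) \prod_(b <- iota j ((rowlen r a).+1 - j))
      cellfac (content (a, b)) =
    \prod_(a <- iota 1 i.-1) (G (j%:Z - a%:Z - 1) / G (j%:Z - (a.-1)%:Z - 1)) *
    \prod_(a <- iota 1 i.-1) (G ((rowlen r a)%:Z - a%:Z + 1) / G ((rowlen r a)%:Z - a%:Z)).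
  rewrite -big_split; apply: eq_big_seq => a; rewrite mem_iota => ha.
  have aj : (a, j) \in r by rewrite hc; lia.
  rewrite hr in aj.
  rewrite -[X in iota X]addn0 iotaDl big_map /content /=.
  under eq_bigr do rewrite PoszD.
  rewrite telescope_up.
  have -> : j%:Z + ((rowlen r a).+1 - j)%N%:Z - a%:Z = (rowlen r a)%:Z - a%:Z + 1 by lia.
  have -> : (rowlen r a)%:Z - a%:Z + 1 - 1 = (rowlen r a)%:Z - a%:Z by lia.
  have -> : j%:Z - a.-1%:Z - 1 = j%:Z - a%:Z by lia.
  by field; rewrite !G0.
rewrite (telescope1 (f := fun b => G b%:Z)) // (telescope1 (f := fun a => G (j%:Z - a%:Z - 1))) //.
rewrite /content /=.
have -> : j%:Z - i.-1%:Z - 1 = j%:Z - i%:Z by lia.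
have -> : j.-1%:Z = j%:Z - 0%:Z - 1 by lia.
set A := \prod_(b <- _) _; set A' := \prod_(a <- _) _.
by field; rewrite !G0.
Qed.
End Telescope.

(** * Quantum hook lengths and the quotient f(mu) / f(lambda) *)

Section HookProduct.
Variables (K : fieldType) (q : K).
Hypothesis qG : generic q.

Let q0 : q != 0. Proof. by case: qG. Qed.

Definition fD (D : seq cell) : K :=
  \prod_(c <- D) (q ^ content c / qint q (hookD D c)).

Lemma qint_neq0 m : (0 < m)%N -> qint q m != 0.
Proof.
move=> m0; rewrite mulf_neq0 ?invr_eq0 ?(qsub_neq0 qG) // subr_eq0.
apply/eqP => e; have : m%:Z = - m%:Z; last by lia.
by apply: (expfz_inj qG); rewrite /= -invr_expz -exprnP.
Qed.

(** Extracts a quantum integer from a difference of contents, so that each factor of [hookval]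
    becomes a power of q times a ratio of consecutive quantum integers. *)
Lemma qcB x y : qc q x - qc q y = q ^ (x + y) * (q ^ (x - y) - q ^ (y - x)).
Proof.
by rewrite mulrBr -!expfzDr // /qc; congr (q ^ _ - q ^ _); ring.
Qed.

Lemma qc_ratio_down x y h : (0 < h)%N -> x - y = h%:Z ->
  (qc q x - qc q (y - 1)) / (qc q x - qc q y) = q^-1 * (qint q h.+1 / qint q h).
Proof.
move=> h0 e; rewrite !qcB.
have -> : x - (y - 1) = h.+1%:Z by lia.
have -> : y - 1 - x = - h.+1%:Z by lia.
have -> : y - x = - h%:Z by lia.
have -> : x + (y - 1) = x + y - 1 by lia.
rewrite e (expfzDr _ (-1)) // /qint -!invr_expz -!exprnP expr1.
have n1 := qint_neq0 h0; move: n1; rewrite /qint mulf_eq0 negb_or => /andP[n1 n2].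
rewrite invr_eq0 in n2; have := expfz_neq0 (x + y) q0.
set A := q ^ (x + y); set B := q ^+ h.+1 - q ^- h.+1; set C := q ^+ h - q ^- h in n1 *.
by move: (q - q^-1) n2 => k n2 A0; field; rewrite q0 n1 A0 n2.
Qed.

Lemma qc_ratio_up x y h : (0 < h)%N -> y - x = h%:Z ->
  (qc q x - qc q (y + 1)) / (qc q x - qc q y) = q * (qint q h.+1 / qint q h).
Proof.
move=> h0 e; rewrite !qcB.
have -> : x - (y + 1) = - h.+1%:Z by lia.
have -> : y + 1 - x = h.+1%:Z by lia.
have -> : x - y = - h%:Z by lia.
have -> : x + (y + 1) = x + y + 1 by lia.
rewrite e (expfzDr _ 1) // /qint -!invr_expz -!exprnP expr1.
have n1 := qint_neq0 h0; move: n1; rewrite /qint mulf_eq0 negb_or => /andP[n1 n2].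
rewrite invr_eq0 in n2; have := expfz_neq0 (x + y) q0.
rewrite -(opprB (q ^+ h.+1)) -(opprB (q ^+ h)).
set A := q ^ (x + y); set B := q ^+ h.+1 - q ^- h.+1; set C := q ^+ h - q ^- h in n1 *.
by move: (q - q^-1) n2 => k n2 A0; field; rewrite oppr_eq0 n1 A0 n2.
Qed.

(** The two products of [cellfac_prod] evaluated at the content of the new cell (i, j). *)
Definition hookval (i j : nat) (r : seq cell) : K :=
  let s := qc q (content (i, j)) in
  \prod_(b <- iota 1 j.-1) ((s - qc q (b%:Z - (collen r b)%:Z - 1)) /
                            (s - qc q (b%:Z - (collen r b)%:Z))) *
  \prod_(a <- iota 1 i.-1) ((s - qc q ((rowlen r a)%:Z - a%:Z + 1)) /
                            (s - qc q ((rowlen r a)%:Z - a%:Z))).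

Lemma prod_iota_const (x : K) m : \prod_(b <- iota 1 m) x = x ^+ m.
Proof.
by elim: m => [|m IH]; rewrite ?big_nil // iotaSr big_cat /= big_seq1 IH exprSr.
Qed.

(** Adding (i, j) raises by one the hook lengths in row i and column j and changes no other; the
    ratios old over new cancel against the factors of [hookval] up to powers of q. *)
Lemma fD_cons i j r : std ((i, j) :: r) -> fD ((i, j) :: r) * hookval i j r = fD r.
Proof.
move=> sr; have [i0 j0 ei ej] := std_head_lens sr.
have [[cr dc] sr'] := sr; have [hc hr] := std_mem sr'.
pose h c := hookD r c; pose h' c := hookD ((i, j) :: r) c.
have hE c : c \in r -> h' c = (h c + (c.1 == i) + (c.2 == j))%N /\ (0 < h c)%N.
  case: c => a b abr; have [h1 h2] := (abr, abr); rewrite hc in h1; rewrite hr in h2.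
  by rewrite /h' /h /hookD /rowlen /collen /= -/(rowlen r a) -/(collen r b)
    (eq_sym i) (eq_sym j); split; lia.
pose x c := qint q (h c) / qint q (h' c).
have h1 : h' (i, j) = 1%N.
  rewrite /h' /hookD /rowlen /collen /= !eqxx -/(rowlen r i) -/(collen r j); lia.
have -> : fD ((i, j) :: r) = q ^ content (i, j) * (fD r * \prod_(c <- r) x c).
  rewrite /fD big_cons -/(h' _) h1; congr (_ * _).
    by rewrite /qint expr1 divff ?divr1 // (qsub_neq0 qG).
  rewrite -big_split; apply: eq_big_seq => c cr'; have [_ c0] := hE c cr'.
  by rewrite -/(h c) /x /= mulrA divfK // qint_neq0.
have -> : \prod_(c <- r) x c =
    (\prod_(b <- iota 1 j.-1) x (i, b)) * (\prod_(a <- iota 1 i.-1) x (a, j)).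
  rewrite (bigID (fun c => c.1 == i)) /=; congr (_ * _).
    rewrite -big_filter -[RHS](big_map (pair i) xpredT x); apply: perm_big.
    apply: uniq_perm; first by rewrite filter_uniq // std_uniq.
      by rewrite map_inj_uniq ?iota_uniq // => b b' [].
    move=> [a b]; rewrite mem_filter hr /=; apply/idP/mapP => [/andP[/eqP -> hb] | [b' hb [-> ->]]].
      by exists b => //; rewrite mem_iota; lia.
    by rewrite mem_iota in hb; rewrite eqxx /=; lia.
  (* Off row i and column j the ratio is 1, and no cell of r lies on both, since that cell is the
     new one. *)
  have -> : \prod_(c <- r | c.1 != i) x c = \prod_(c <- r | c.2 == j) x c.
    rewrite big_mkcond [RHS]big_mkcond; apply: eq_big_seq => -[a b] abr.
    have [e _] := hE _ abr; rewrite /= in e *.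
    case: (eqVneq a i) => [ea | na] /=; case: (eqVneq b j) => [eb | nb] //=.
      by move: cr; rewrite -ea -eb abr.
    rewrite /x e (negbTE na) (negbTE nb) !addn0 divff // qint_neq0 //.
    by have [] := hE _ abr.
  rewrite -big_filter -[RHS](big_map (pair^~ j) xpredT x); apply: perm_big.
  apply: uniq_perm; first by rewrite filter_uniq // std_uniq.
    by rewrite map_inj_uniq ?iota_uniq // => b b' [].
  move=> [a b]; rewrite mem_filter hc /=; apply/idP/mapP => [/andP[/eqP -> hb] | [b' hb [-> ->]]].
    by exists a => //; rewrite mem_iota; lia.
  by rewrite mem_iota in hb; rewrite eqxx /=; lia.
rewrite /hookval; set s := qc q _.
have eA : \prod_(b <- iota 1 j.-1) x (i, b) *
    \prod_(b <- iota 1 j.-1) ((s - qc q (b%:Z - (collen r b)%:Z - 1)) /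
                              (s - qc q (b%:Z - (collen r b)%:Z))) = q^-1 ^+ j.-1.
  rewrite -big_split -prod_iota_const; apply: eq_big_seq => b; rewrite mem_iota => hb.
  have ibr : (i, b) \in r by rewrite hr; lia.
  have [e p] := hE _ ibr; rewrite /= eqxx in e; have := ibr; rewrite hc => ib.
  rewrite (qc_ratio_down (h := h (i, b))) //; last first.
    by rewrite /content /h /hookD /=; lia.
  rewrite /x e (_ : (b == j) = false); last by lia.
  have f0 := qint_neq0 p; have f1 := qint_neq0 (ltn0Sn (h (i, b))).
  rewrite addn0 addn1 /=; move: f0 f1; move: (qint q _) (qint q _.+1) => A A' A0 A'0.
  by field; rewrite ?q0 A0 A'0.
have eB : \prod_(a <- iota 1 i.-1) x (a, j) *
    \prod_(a <- iota 1 i.-1) ((s - qc q ((rowlen r a)%:Z - a%:Z + 1)) /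
                              (s - qc q ((rowlen r a)%:Z - a%:Z))) = q ^+ i.-1.
  rewrite -big_split -prod_iota_const; apply: eq_big_seq => a; rewrite mem_iota => ha.
  have ajr : (a, j) \in r by rewrite hc; lia.
  have [e p] := hE _ ajr; rewrite /= eqxx in e; have := ajr; rewrite hr => aj.
  rewrite (qc_ratio_up (h := h (a, j))) //; last first.
    by rewrite /content /h /hookD /=; lia.
  rewrite /x e (_ : (a == i) = false); last by lia.
  have f0 := qint_neq0 p; have f1 := qint_neq0 (ltn0Sn (h (a, j))).
  rewrite addn0 addn1 /=; move: f0 f1; move: (qint q _) (qint q _.+1) => A A' A0 A'0.
  by field; rewrite ?q0 A0 A'0.
(* The remaining powers q^(j-i), q^-(j-1) and q^(i-1) multiply to 1; this is why f contains q to the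
   content. *)
rewrite [LHS](AC ((1 * (1 * 2)) * 2) (2 * (1 * ((3 * 5) * (4 * 6))))) /= eA eB.
rewrite -[RHS]mulr1; congr (_ * _).
by rewrite !exprnP exprz_inv -!expfzDr // (_ : _ + _ = 0) // /content /=; lia.
Qed.
End HookProduct.

(** * The consecutive evaluations *)

Section Fusion.
Variables (K : fieldType) (q : K) (n : nat) (cl : nat -> cell) (L : nat -> seq int).
Hypotheses (qG : generic q) (n0 : (0 < n)%N).

Fixpoint tab (m : nat) : seq cell := if m is m'.+1 then cl m :: tab m' else [::].

Hypothesis tab_std : std (tab n).
Hypothesis L_uniq : forall m, (m < n)%N -> uniq (L m).
Hypothesis L_add : forall m c, (m < n)%N -> addcell (tab m) c -> content c \in L m.

Local Notation H := (hecke q n).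
Local Notation hT := (hT q n).
Local Notation R := (ratfun K n).
Local Notation cst := (ratconst K n).
Local Notation sg k := (qc q (content (cl k))).
Local Notation T := (fun i => ten (hT i)).
Local Notation q' := (cst q).

Lemma size_tab m : size (tab m) = m. Proof. by elim: m => //= m ->. Qed.

Lemma std_tab m : (m <= n)%N -> std (tab m).
Proof.
move=> mn; have -> : m = (n - (n - m))%N by lia.
elim: (n - m)%N => [|d IH]; first by rewrite subn0.
case: (ltnP d n) => dn; last by rewrite (_ : n - d.+1 = 0)%N //; lia.
by rewrite (_ : n - d = (n - d.+1).+1)%N in IH; [case: IH | lia].
Qed.

(** Starts from 1 at m = 0, so that the first cell too is an eigenpart; [idem_tab] compares it with
    [idem]. *)
Fixpoint idemE (m : nat) : H :=
  if m is m'.+1 then eigenpart q (L m') (gjm hT m) (idemE m') (content (cl m)) else 1.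

Let HG := hecke_gens_hT q n0.

Lemma rootprod_L m w : (m < n)%N -> rwt q hT w (map content (tab m)) ->
  w * rootprod q (L m) (gjm hT m.+1) = 0.
Proof.
move=> mn ws; have [|L0 [u0 a0 k0]] := bounded_std HG qG (std_tab (ltnW mn)).
  by rewrite size_tab.
have sL : {subset L0 <= L m} by move=> d /a0[c ac <-]; apply: L_add.
have [R ->] := rootprod_subset q (gjm hT m.+1) u0 (L_uniq mn) sL.
by have := k0 w ws; rewrite size_tab mulrA => ->; rewrite mul0r.
Qed.

Lemma cl_L m : (m < n)%N -> content (cl m.+1) \in L m.
Proof. by move=> mn; apply: L_add => //; have [] := std_tab mn. Qed.

Lemma idemE_rwt m : (m <= n)%N -> rwt q hT (idemE m) (map content (tab m)).
Proof.
elim: m => // m IH mn; have Em := IH (ltnW mn).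
split; last first.
  apply: eigenpart_rwt Em => i; rewrite size_map size_tab => ii.
  by apply: (gjmC HG); lia.
rewrite /= size_map size_tab.
by apply: eigenpartP; [apply: cl_L | apply: rootprod_L].
Qed.

Lemma hecke_gens_ten : hecke_gens q' n T.
Proof.
case: HG => br co qu; split=> [i i0 iN | i j i0 ij jN | i iN].
- by rewrite -!tenM br.
- by rewrite -!tenM co.
by rewrite -tenM qu // tenD ten1 tenZ rmorphB fmorphV.
Qed.

Lemma ten_gV i : ten (gV q hT i) = gV q' T i.
Proof. by rewrite /gV tenB tenZ ten1 rmorphB fmorphV. Qed.

Lemma ten_gjm k : ten (gjm hT k) = gjm T k.
Proof.
elim: k => [|[|k] IH]; rewrite ?ten1 //.
by rewrite [gjm hT _]/(hT k.+1 * gjm hT k.+1 * hT k.+1) !tenM IH.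
Qed.

Lemma ten_gdown k : ten (gdown hT k) = gdown T k.
Proof. by elim: k => [|k IH]; rewrite ?ten1 //= tenM IH. Qed.

Lemma ten_glong k : ten (glong hT k) = glong T k.
Proof. by elim: k => [|k IH]; rewrite ?ten1 //= tenM IH ten_gdown. Qed.

Lemma rwt_gwt w m : (m <= n)%N -> rwt q hT w (map content (tab m)) ->
  gwt T (ten w) m (fun k => cst (sg k)).
Proof.
elim: m => [|m IH] mn ws k km; first by lia.
have [w1 w2] := ws; case: (eqVneq k m.+1) => [-> | ne].
  move: w1; rewrite /= size_map size_tab => w1.
  by rewrite -ten_gjm -tenM w1 tenZ.
by apply: IH w2 _ _; lia.
Qed.

Lemma hT_unit i : (0 < i < n)%N -> hT i \is a GRing.unit.
Proof. by move=> iN; apply/unitrP; exists (gV q hT i); rewrite (gVmul HG) // (gmulV HG). Qed.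

Lemma hT_inv i : (0 < i < n)%N -> (hT i)^-1 = gV q hT i.
Proof. by move=> iN; apply: (mulrI (hT_unit iN)); rewrite mulrV ?hT_unit // (gmulV HG). Qed.

Lemma gdown_unit m : (m < n)%N -> gdown hT m \is a GRing.unit.
Proof.
elim: m => [|m IH] mn; first exact: unitr1.
by rewrite /= unitrMl ?hT_unit // IH //; lia.
Qed.

Lemma glong_unit m : (m <= n)%N -> glong hT m \is a GRing.unit.
Proof.
elim: m => [|m IH] mn; first exact: unitr1.
by rewrite /= unitrMl ?gdown_unit // IH //; lia.
Qed.

Lemma baxterE i x y : (0 < i < n)%N -> @baxter K q n i x y = gbaxter q' T i x y.
Proof. by move=> iN; rewrite /baxter hT_inv // /gbaxter -ten_gV. Qed.

(* The variables after the first m evaluations. *)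
Definition uev (m j : nat) : R := if (j <= m)%N then cst (sg j) else uvar K n j.

Definition Yev (m k : nat) : hfun q n :=
  \prod_(1 <= j < k.+1) gbaxter q' T (k.+1 - j) (uev m j) (uev m k.+1).

(** After m evaluations the blocks with k < m contain no variable and have collapsed to E_m T_(w_m)
    / f. The block k = 0 is empty, which makes [Phi 0] equal to [Psi]. *)
Definition Phi (m : nat) : hfun q n :=
  ten ((fD q (tab m))^-1 *: (idemE m * glong hT m)) *
  \prod_(m <= k < n) Yev m k * ten (hTw q (wlongest n))^-1.

Lemma Phi0 : Phi 0 = Psi q n.
Proof.
rewrite /Phi /Psi /fD big_nil invr1 scale1r mulr1 ten1 mul1r; congr (_ * _).
rewrite big_ltn // /Yev big_nil mul1r; apply: eq_big_nat => k kn.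
have uE i : (0 < i)%N -> uev 0 i = uvar K n i by move=> i0; rewrite /uev leqNgt i0.
apply: eq_big_nat => j jk; rewrite baxterE; last by lia.
by congr gbaxter; apply: uE; lia.
Qed.

Lemma fD_neq0 m : (m <= n)%N -> fD q (tab m) != 0.
Proof.
move=> mn; have q0 := proj1 qG; rewrite /fD prodf_seq_neq0; apply/allP => -[a b] abr /=.
have [hc hr] := std_mem (std_tab mn).
have [h1 h2] := (abr, abr); rewrite hc in h1; rewrite hr in h2.
rewrite mulf_neq0 ?expfz_neq0 ?invr_eq0 // (qint_neq0 qG) // /hookD /=; lia.
Qed.

Lemma PhiN : Phi n = ten ((fD q (tab n))^-1 *: idemE n).
Proof.
rewrite /Phi big_geq // mulr1 -tenM (hTw_longest q n0) -scalerAl -mulrA.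
by rewrite mulrV ?mulr1 // glong_unit.
Qed.

Lemma reval_uvar (m : 'I_n) s : reval m s (uvar K n m.+1) (cst s).
Proof. by rewrite uvarE; have := reval_frac m s 'X_m; rewrite psubstX eqxx. Qed.

Lemma reval_uvar_neq (m j : 'I_n) s : j != m -> reval m s (uvar K n j.+1) (uvar K n j.+1).
Proof.
by move=> jm; rewrite !uvarE; have := reval_frac m s 'X_j; rewrite psubstX (negbTE jm).
Qed.

Lemma heval_gbaxter (m : 'I_n) s i x y x' y' : y' != x' ->
  reval m s x x' -> reval m s y y' ->
  heval m s (gbaxter q' T i x y) (gbaxter q' T i x' y').
Proof.
move=> yx' hx hy; rewrite /gbaxter; apply: hevalZ.
  by apply: revalV; [rewrite subr_eq0 | apply: revalB].
rewrite -scaleNr -scaleNr; apply: heval_add; first exact: heval_scale.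
by rewrite -ten_gV; apply: heval_scale; apply: revalN.
Qed.

(** The second argument of every factor is still the variable u_(k+1), distinct from all constants
    and from the other variables, so each factor is regular by itself. *)
Lemma heval_Yev (m : 'I_n) k : (m < k < n)%N ->
  heval m (sg m.+1) (Yev m k) (Yev m.+1 k).
Proof.
move=> /andP[mk kn]; apply: heval_prod => j; rewrite mem_index_iota => jk.
have uk m' : (m' <= k)%N -> uev m' k.+1 = uvar K n k.+1.
  by move=> mk'; rewrite /uev ltnNge mk'.
have kP := erefl (val (Ordinal kn)).
rewrite !uk //; last by exact: ltnW.
apply: heval_gbaxter.
- rewrite /uev; case: ifP => jm; first exact: (uvar_neq_const (Ordinal kn)).
  have j1n : (j.-1 < n)%N by lia.
  have := @uvar_inj K n (Ordinal kn) (Ordinal j1n); rewrite /= prednK; last by lia.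
  by apply; rewrite -val_eqE /=; lia.
- rewrite /uev; case: (ltngtP j m.+1) => jm.
  + by rewrite -ltnS jm; apply: reval_const.
  + rewrite leqNgt (ltnW jm) /=.
    have j1n : (j.-1 < n)%N by lia.
    have := @reval_uvar_neq m (Ordinal j1n) (sg m.+1); rewrite /= prednK; last by lia.
    by apply; rewrite -val_eqE /=; lia.
  by rewrite jm ltnn; apply: reval_uvar.
by apply: (@reval_uvar_neq m (Ordinal kn)); rewrite -val_eqE /=; lia.
Qed.

(** * Evaluation of one variable *)

Section Step.
Variable m : 'I_n.
Let u := uvar K n m.+1.
Let s := sg m.+1.
Let G (d : int) : R := u - cst (qc q d).

Let G0 d : G d != 0.
Proof. by rewrite subr_eq0 uvar_neq_const. Qed.

Lemma gc_cellfac j : gc q' (fun k => cst (sg k)) u j =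
  \prod_(c <- tab j) cellfac G (content c).
Proof.
elim: j => [|j IH]; first by rewrite /gc !big_nil.
rewrite /gc big_nat_recr //= -/(gc _ _ _ _) IH big_cons mulrC; congr (_ * _).
by rewrite /cellfac /G (qcD1 qG) (qcB1 qG) !rmorphM fmorphV rmorphXn.
Qed.

Lemma reval_G d : reval m s (G d) (cst (s - qc q d)).
Proof.
by rewrite rmorphB; apply: revalB; [apply: reval_uvar | apply: reval_const].
Qed.

(** By [cellfac_prod] the numerator contains G at the new content, which vanishes at u = s. Dividing
    by G d cancels this zero if d is the new content; otherwise G d does not vanish there and the
    value is 0. The free ends of columns and rows have contents different from the new one, so the
    other factors are regular. *)
Lemma reval_coef d : reval m s
  ((u - 1) * gc q' (fun k => cst (sg k)) u m / G d)
  (if d == content (cl m.+1) then cst (hookval q (cl m.+1).1 (cl m.+1).2 (tab m)) else 0).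
Proof.
have sm : std (((cl m.+1).1, (cl m.+1).2) :: tab m).
  by rewrite -surjective_pairing; apply: (@std_tab m.+1).
have -> : u - 1 = G 0 by rewrite /G /qc mulr0 expr0z rmorph1.
rewrite gc_cellfac (cellfac_prod G0 sm) -surjective_pairing mulrAC.
have eG : reval m s (G (content (cl m.+1)) / G d)
    (if d == content (cl m.+1) then 1 else 0).
  case: eqVneq => [-> | nd].
    by rewrite divff // -(rmorph1 cst); apply: reval_const.
  have := revalM (reval_G (content (cl m.+1))) (revalV _ (reval_G d)).
  rewrite subrr rmorph0 mul0r; apply; rewrite fmorph_eq0 subr_eq0.
  by rewrite (inj_eq (qc_inj qG)) eq_sym.
have hG y z : s != qc q z ->
    reval m s (G y / G z) (cst ((s - qc q y) / (s - qc q z))).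
  move=> sz; rewrite fmorph_div; apply: revalM; first exact: reval_G.
  by apply: revalV; [rewrite fmorph_eq0 subr_eq0 | exact: reval_G].
have [i0 j0 ei ej] := std_head_lens sm; have [[cr dc] sr'] := sm.
have [hc hr] := std_mem sr'.
set i := (cl m.+1).1 in sm i0 j0 ei ej cr dc *; set j := (cl m.+1).2 in sm i0 j0 ei ej cr dc *.
have sE : s = qc q (j%:Z - i%:Z) by [].
have hV : reval m s
   (\prod_(b <- iota 1 j.-1) (G (b%:Z - (collen (tab m) b)%:Z - 1) /
      G (b%:Z - (collen (tab m) b)%:Z)) *
    \prod_(a <- iota 1 i.-1) (G ((rowlen (tab m) a)%:Z - a%:Z + 1) /
      G ((rowlen (tab m) a)%:Z - a%:Z)))
   (cst (hookval q i j (tab m))).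
  rewrite /hookval rmorphM !rmorph_prod; apply: revalM; apply: reval_prod => x;
    rewrite mem_iota => hx; apply: hG; rewrite sE (inj_eq (qc_inj qG)).
    have : (i, x) \in tab m by rewrite hr; lia.
    by rewrite hc; lia.
  have : (x, j) \in tab m by rewrite hc; lia.
  by rewrite hr; lia.
by have := revalM eG hV; case: ifP => _; rewrite ?mul1r ?mul0r.
Qed.

Lemma fusion_eigen d : d \in L m ->
  let v := ten (eigenpart q (L m) (gjm hT m.+1) (idemE m) d) in
  v * (gupV q' T m * gZ q' T (fun k => cst (sg k)) u m) =
  ((u - 1) * gc q' (fun k => cst (sg k)) u m / G d) *: v.
Proof.
move=> dL; set w := eigenpart _ _ _ _ _ => v.
have Em := idemE_rwt (ltnW (ltn_ord m)).
have wr : rwt q hT w (map content (tab m)).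
  apply: eigenpart_rwt Em => i; rewrite size_map size_tab => ii.
  by have := ltn_ord m; move=> mn; apply: (gjmC HG); lia.
have wy : w * gjm hT m.+1 = qc q d *: w.
  by apply: eigenpartP => //; apply: rootprod_L.
rewrite /v; clearbody w; clear v.
have := gwt_fusion hecke_gens_ten (ltn_ord m) _ _ (rwt_gwt (ltnW (ltn_ord m)) wr).
move=> /(_ u) fus; rewrite mulrC -scalerA -fus.
- rewrite mulrBr mulr_algr -ten_gjm -tenM wy tenZ -scalerBl -!scalerAl scalerA.
  by rewrite mulVf // scale1r mulrA.
- by rewrite fmorph_eq0; case: qG.
by move=> k _; apply: uvar_neq_const.
Qed.

Lemma heval_Phi : heval m s (Phi m) (Phi m.+1).
Proof.
have mn := ltn_ord m; have Em := idemE_rwt (ltnW mn).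
rewrite /Phi big_ltn // mulrA; apply: hevalM; last exact: heval_ten.
apply: hevalM; last first.
  by apply: heval_prod => k; rewrite mem_index_iota => ?; apply: heval_Yev.
have -> : Yev m m = gY q' T (fun k => cst (sg k)) u m.
  apply: eq_big_nat => j jm; rewrite /uev ltnn; congr (gbaxter _ _ _ _ _).
  by rewrite -ltnS (andP jm).2.
rewrite tenZ tenM ten_glong -scalerAl -mulrA (glong_gY hecke_gens_ten) // mulrA.
rewrite -ten_glong.
have -> : ten (idemE m) * (gupV q' T m * gZ q' T (fun k => cst (sg k)) u m) =
    \sum_(d <- L m) ((u - 1) * gc q' (fun k => cst (sg k)) u m / G d) *:
      ten (eigenpart q (L m) (gjm hT m.+1) (idemE m) d).
  rewrite {1}(eigenpart_sum qG (L_uniq mn) (rootprod_L mn Em)) ten_sum mulr_suml.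
  by apply: eq_big_seq => d dL; apply: fusion_eigen.
(* By [fD_cons], V is f for the first m cells over f for the first m+1 cells; it supplies the
   normalisation of the next function. *)
pose V := hookval q (cl m.+1).1 (cl m.+1).2 (tab m).
have -> : ten ((fD q (tab m.+1))^-1 *: (idemE m.+1 * glong hT m.+1)) =
    cst ((fD q (tab m))^-1) *: (cst V *: ten (idemE m.+1) * ten (glong hT m.+1)).
  move: (idemE m.+1) (glong hT m.+1) => E W.
  rewrite -scalerAl scalerA -tenM tenZ; congr (_ *: _).
  rewrite -(rmorphM cst); congr (cst _).
  have sm : std (((cl m.+1).1, (cl m.+1).2) :: tab m).
    by rewrite -surjective_pairing; apply: (@std_tab m.+1).
  have := fD_neq0 (ltnW mn).
  rewrite -(fD_cons qG sm) -surjective_pairing -/(tab m.+1) mulf_eq0 negb_or.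
  by move=> /andP[_ V0]; rewrite invfM divfK.
have -> : cst V *: ten (idemE m.+1) = \sum_(d <- L m)
    (if d == content (cl m.+1) then cst V else 0) *:
      ten (eigenpart q (L m) (gjm hT m.+1) (idemE m) d).
  rewrite (bigD1_seq (content (cl m.+1))) ?cl_L ?L_uniq // eqxx big1 ?Monoid.mulm1 //.
  by move=> d /negbTE ->; rewrite scale0r.
apply: hevalZ; first exact: reval_const.
apply: hevalM; last exact: heval_ten.
apply: heval_sum => d dL; apply: hevalZ; first exact: reval_coef.
exact: heval_ten.
Qed.
End Step.
End Fusion.

(** * Partitions and their standard tableaux *)

Lemma mem_diagram lam i j :
  ((i, j) \in diagram lam) = [&& (0 < i)%N, (i <= size lam)%N, (0 < j)%N & (j <= part lam i)%N].
Proof.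
apply/allpairsPdep/idP => [[a [b [ha hb [-> ->]]]] | h].
  by rewrite !mem_iota in ha hb; lia.
by exists i, j; rewrite !mem_iota; split=> //; lia.
Qed.

Lemma part_anti lam i : is_partition lam -> (0 < i)%N -> (part lam i.+1 <= part lam i)%N.
Proof.
move=> /andP[/(sortedP 0%N) sl _] i0; rewrite /part /=.
case: (ltnP i (size lam)) => il; last by rewrite nth_default.
by have := sl i.-1; rewrite prednK //; apply.
Qed.

Lemma diagram_downset lam : is_partition lam -> downset (diagram lam).
Proof.
move=> pl i j; rewrite mem_diagram => /and4P[i0 il j0 jl]; split=> // h; rewrite mem_diagram.
  have := part_anti (i := i.-1) pl; rewrite prednK // => /(_ ltac:(lia)); lia.
by lia.
Qed.

Lemma diagram_uniq lam : uniq (diagram lam).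
Proof.
apply: allpairs_uniq_dep => [|i _|]; rewrite ?iota_uniq //.
by move=> [a b] [a' b'] _ _ /= [-> ->].
Qed.

(** Reads the same diagram by rows and by columns, which identifies [collen] with the conjugate
    partition in [hook_tab]. *)
Lemma count_sorted_geq lam j a : sorted geq lam -> (0 < j)%N ->
  (j <= nth 0 lam a)%N = (a < count (fun r => j <= r) lam)%N.
Proof.
elim: lam a => [|x lam IH] a sl j0; first by rewrite nth_nil /=; lia.
have sl' := path_sorted sl.
have c0 : (x < j)%N -> count (fun r => j <= r)%N lam = 0%N.
  move=> xj; apply/eqP; rewrite -leqn0 leqNgt -has_count; apply/hasPn => y yl.
  have /allP/(_ y yl) := order_path_min (fun b a c ab bc => leq_trans bc ab) sl.
  by rewrite /geq /=; lia.
case: a => [|a] /=; first by case: (leqP j x) => // xj; rewrite (c0 xj).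
by rewrite IH //; case: (leqP j x) => // xj; rewrite (c0 xj).
Qed.

Lemma std_rowlen_le r a b : std r -> (a, b) \in r -> (a <= size r)%N && (b <= size r)%N.
Proof.
move=> sr abr; have [hc hr] := std_mem sr.
have [h1 h2] := (abr, abr); rewrite hc in h1; rewrite hr in h2.
have := count_size (fun c : cell => c.1 == a) r; rewrite -/(rowlen r a).
have := count_size (fun c : cell => c.2 == b) r; rewrite -/(collen r b); lia.
Qed.

Lemma std_is_diagram r : std r -> is_diagram r.
Proof.
move=> sr; have [hc hr] := std_mem sr; have dr := std_downset sr.
apply/asboolP; exists [seq rowlen r i | i <- iota 1 (collen r 1)].
  apply/andP; split.
    apply/(sortedP 0%N) => i; rewrite size_map size_iota => ih.
    rewrite !(nth_map 0%N) ?size_iota ?nth_iota; try lia.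
    rewrite !add1n /geq /=; case: (posnP (rowlen r i.+2)) => [->//|p].
    have /(dr _ _)[_ _ h _] : (i.+2, rowlen r i.+2) \in r by rewrite hr; lia.
    by move: (h isT) => /=; rewrite hr; lia.
  apply/mapP => -[ i ]; rewrite mem_iota => hi e.
  have : (i, 1%N) \in r by rewrite hc; lia.
  by rewrite hr -e; lia.
move=> [i j]; rewrite mem_diagram size_map size_iota /part.
apply/idP/idP => [ijr | /and4P[i0 il j0]].
  have [h1 h2] := (ijr, ijr); rewrite hc in h1; rewrite hr in h2.
  have i1 : (i, 1%N) \in r by apply: (downset_le dr ijr); lia.
  rewrite hc in i1; rewrite (nth_map 0%N) ?size_iota ?nth_iota; try lia.
  by rewrite add1n prednK; lia.
rewrite (nth_map 0%N) ?size_iota ?nth_iota; try lia.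
by rewrite add1n prednK // hr => ->; rewrite j0 i0.
Qed.

Lemma addableP r c : std r -> addable r c <-> addcell r c.
Proof.
move=> sr; split=> [/andP[cr /asboolP[nu pn e]] | ac].
  by split=> //; apply: downset_eq (diagram_downset pn) => x; rewrite e.
by rewrite /addable ac.1; apply: (@std_is_diagram (c :: r)).
Qed.

Lemma mem_addable_cells r c : std r -> c \in addable_cells r <-> addcell r c.
Proof.
move=> sr; rewrite /addable_cells mem_filter; split=> [/andP[/(addableP _ sr)] // | ac].
rewrite (proj2 (addableP c sr) ac) andTb.
case: c ac => i j ac; have src : std ((i, j) :: r) by [].
have [h1 h2] := andP (std_rowlen_le src (mem_head _ _)).
have [i0 j0 _ _] := ac.2 _ _ (mem_head _ _).
by apply/allpairsPdep; exists i, j; rewrite !mem_iota /= in h1 h2 *; split=> //; lia.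
Qed.

Lemma addcell_content_inj r c c' : std r -> addcell r c -> addcell r c' ->
  content c = content c' -> c = c'.
Proof.
move=> sr ac ac' e; apply/eqP/negPn/negP => ne.
by have := addcell_apart (std_downset sr) ac ac' ne; rewrite e; lia.
Qed.

Lemma addcell_nil c : addcell [::] c -> c = (1, 1)%N.
Proof.
case: c => i j [_ dij]; have [i0 j0 hi hj] := dij _ _ (mem_head _ _).
have i1 : ~ (1 < i)%N by move=> /hi; rewrite inE xpair_eqE; lia.
have j1 : ~ (1 < j)%N by move=> /hj; rewrite inE xpair_eqE; lia.
by congr pair; lia.
Qed.

Lemma addable_cells_content_uniq r : std r -> uniq (map content (addable_cells r)).
Proof.
move=> sr; rewrite map_inj_in_uniq.
  apply: filter_uniq; apply: allpairs_uniq; rewrite ?iota_uniq //.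
  by move=> [a b] [a' b'] _ _ /= [-> ->].
move=> c c' /(mem_addable_cells _ sr) ac /(mem_addable_cells _ sr) ac'.
exact: (addcell_content_inj sr ac ac').
Qed.

Lemma cell_ofK D t c : uniq (map t D) -> c \in D -> cell_of D t (t c) = c.
Proof.
move=> uD cD; rewrite /cell_of.
have -> : t c = nth 0%N (map t D) (index c D).
  by rewrite (nth_map (0, 0)%N) ?nth_index // index_mem.
by rewrite index_uniq ?nth_index // size_map index_mem.
Qed.

Lemma cell_of_mem D t k : k \in map t D -> cell_of D t k \in D /\ t (cell_of D t k) = k.
Proof.
move=> kD; rewrite /cell_of; have ik : (index k (map t D) < size D)%N.
  by rewrite -(size_map t) index_mem.
split; first exact: mem_nth.
by rewrite -(nth_map _ 0%N) // nth_index.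
Qed.

Section Tableau.
Variables (lam : seq nat) (t : cell -> nat).
Hypotheses (lamP : is_partition lam) (tS : is_standard lam t).
Local Notation D := (diagram lam).
Local Notation n := (sumn lam).
Local Notation cl := (cell_of D t).

Let tD : perm_eq [seq t c | c <- D] (iota 1 n). Proof. by case: tS. Qed.

Let uD : uniq (map t D). Proof. by rewrite (perm_uniq tD) iota_uniq. Qed.

Let tr c : c \in D -> (0 < t c <= n)%N.
Proof. by move=> cD; have := map_f t cD; rewrite (perm_mem tD) mem_iota; lia. Qed.

Let clP k : (0 < k <= n)%N -> cl k \in D /\ t (cl k) = k.
Proof. by move=> kn; apply: cell_of_mem; rewrite (perm_mem tD) mem_iota; lia. Qed.

Lemma mem_tab m c : (m <= n)%N -> (c \in tab cl m) = (c \in D) && (t c <= m)%N.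
Proof.
elim: m => [|m IH] mn.
  by rewrite in_nil; apply/esym/negbTE/negP => /andP[/tr]; lia.
have [clD tcl] := clP (k := m.+1) ltac:(lia).
rewrite inE IH; last exact: ltnW.
case: eqVneq => [-> | ne]; first by rewrite clD tcl leqnn.
case: (boolP (c \in D)) => //= cD; rewrite [RHS]leq_eqVlt ltnS.
by case: eqVneq => // e; move: ne; rewrite -e cell_ofK ?eqxx.
Qed.

Lemma tab_std_of m : (m <= n)%N -> std (tab cl m).
Proof.
elim: m => // m IH mn; have [clD tcl] := clP (k := m.+1) ltac:(lia).
split; last by apply: IH; exact: ltnW.
split; first by rewrite mem_tab ?(ltnW mn) // clD tcl /=; lia.
have inT c : (c \in tab cl m.+1) = (c \in D) && (t c <= m.+1)%N by apply: mem_tab.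
suff : downset (tab cl m.+1) by [].
move=> i j; rewrite inT => /andP[ijD tij].
have [i0 j0 hi hj] := diagram_downset lamP ijD; case: tS => _ srow scol.
split=> // [i1|j1]; rewrite inT ?hi ?hj //=.
  by apply: leq_trans tij; apply/ltnW/(scol _ _ _ (hi i1) ijD); rewrite prednK.
by apply: leq_trans tij; apply/ltnW/(srow _ _ _ (hj j1) ijD); rewrite prednK.
Qed.

Lemma tab_perm : perm_eq (tab cl n) D.
Proof.
apply: uniq_perm; [exact/std_uniq/tab_std_of | exact: diagram_uniq|].
by move=> c; rewrite mem_tab //; case: (boolP (c \in D)) => // /tr /andP[_ ->].
Qed.

Lemma jm_gjm (K : fieldType) (q : K) m : jm q n m = gjm (hT q n) m.
Proof. by []. Qed.

Definition tabroots (m : nat) : seq int := map content (addable_cells (tab cl m)).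

(** Only a permutation of [tab] is required: [idem] deletes cells from the row-by-row list of the
    diagram, whereas [tab] orders them by their entries. *)
Lemma idem_tab (K : fieldType) (q : K) m (D' : seq cell) :
  (m <= n)%N -> perm_eq D' (tab cl m) -> idem q n m D' t = idemE q n cl tabroots m.
Proof.
elim: m D' => // m IH D' mn pD'.
have sm := tab_std_of (ltnW mn).
have uD' : uniq (map t D').
  rewrite (perm_uniq (perm_map t pD')) map_inj_in_uniq; first exact/std_uniq/tab_std_of.
  move=> c c'; rewrite !mem_tab // => /andP[cD _] /andP[c'D _] e.
  by rewrite -(cell_ofK uD cD) e cell_ofK.
have [clD tcl] := clP (k := m.+1) ltac:(lia).
have clD' : cl m.+1 \in D' by rewrite (perm_mem pD') mem_head.
have ea : cell_of D' t m.+1 = cl m.+1 by rewrite -{1}tcl cell_ofK.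
set A := addable_cells (tab cl m).
have uA : uniq (map content A) by apply: addable_cells_content_uniq.
have aA : cl m.+1 \in A by apply/(mem_addable_cells _ sm); case: (tab_std_of mn).
have prem : perm_eq (rem (cl m.+1) D') (tab cl m).
  by rewrite -(perm_cons (cl m.+1)) -(permPl (perm_to_rem clD')).
have eA : addable_cells (rem (cl m.+1) D') = A.
  rewrite /A /addable_cells (perm_size prem); apply: eq_filter => c.
  rewrite /addable (perm_mem prem); congr (_ && _).
  by apply: asbool_equiv_eq; split=> -[nu pn e]; exists nu => // c';
    rewrite -e !inE (perm_mem prem).
have erem : [seq content c | c <- A & c != cl m.+1] = rem (content (cl m.+1)) (map content A).
  rewrite rem_filter // filter_map; congr map; apply: eq_in_filter => c cA /=.
  congr negb; apply/eqP/eqP => [-> // | e].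
  exact: (addcell_content_inj sm (proj1 (mem_addable_cells _ sm) cA)
    (proj1 (mem_addable_cells _ sm) aA) e).
have stepE : idemE q n cl tabroots m.+1 =
    idem q n m (rem (cl m.+1) D') t *
    ((\prod_(r <- [seq qcontent q c | c <- A & c != cl m.+1]) (qcontent q (cl m.+1) - r))^-1 *:
     \prod_(r <- [seq qcontent q c | c <- A & c != cl m.+1]) (jm q n m.+1 - r%:A)).
  rewrite [LHS]/(eigenpart q (map content A) (gjm (hT q n) m.+1) (idemE q n cl tabroots m) _).
  rewrite -(IH _ (ltnW mn) prem) /eigenpart -scalerAr -erem /rootprod !big_map jm_gjm.
  by [].
rewrite stepE; case: m => [|m] in sm mn pD' clD tcl clD' ea A uA aA prem eA erem stepE IH *.
  (* [idem] stops at 1 for one cell; on the other side (1, 1) is the only cell addable to the empty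
     diagram, so no root is left. *)
  have -> : [seq c <- A | c != cl 1] = [::].
    apply/eqP; rewrite -(negbK (_ == _)) -has_filter; apply/hasPn => c cA /=.
    have a1 r : r \in A -> r = (1, 1)%N.
      by move/(proj1 (mem_addable_cells _ sm))/addcell_nil.
    by rewrite (a1 c cA) (a1 _ aA) eqxx.
  by rewrite !big_nil invr1 scale1r mulr1.
by rewrite /= ea eA.
Qed.

Lemma hook_tab c : c \in D -> hookD (tab cl n) c = hook lam c.
Proof.
case: c => a b abD; have [hc hr] := std_mem (tab_std_of (leqnn n)).
have memD x y : ((x, y) \in tab cl n) =
    [&& (0 < x)%N, (x <= size lam)%N, (0 < y)%N & (y <= part lam x)%N].
  by rewrite (perm_mem tab_perm) mem_diagram.
have := abD; rewrite mem_diagram => /and4P[a0 al b0 bl].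
have er : rowlen (tab cl n) a = part lam a.
  apply/eqP; rewrite eqn_leq; apply/andP; split.
    case: (posnP (rowlen (tab cl n) a)) => [-> // | p].
    have : (a, rowlen (tab cl n) a) \in tab cl n by rewrite hr leqnn p a0.
    by rewrite memD => /and4P[].
  have : (a, part lam a) \in tab cl n by rewrite memD a0 al leqnn andbT; lia.
  by rewrite hr => /andP[/andP[]].
have colE x : (0 < x)%N -> ((x, b) \in tab cl n) = (x <= conj_part lam b)%N.
  case: x => // x _; rewrite memD /conj_part -count_sorted_geq //; last by case/andP: lamP.
  rewrite b0 /part /=; case: (ltnP x (size lam)) => // xl.
  by rewrite nth_default // leqNgt b0.
have ec : collen (tab cl n) b = conj_part lam b.
  apply/eqP; rewrite eqn_leq; apply/andP; split.
    case: (posnP (collen (tab cl n) b)) => [-> // | p].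
    by rewrite -colE // hc leqnn p b0.
  case: (posnP (conj_part lam b)) => [-> // | p].
  have : (conj_part lam b, b) \in tab cl n by rewrite colE.
  by rewrite hc => /andP[/andP[]].
by rewrite /hookD /hook /= er ec.
Qed.

Lemma fcoef_tab (K : fieldType) (q : K) : fcoef q lam = fD q (tab cl n).
Proof.
rewrite /fD (perm_big _ tab_perm) /=; apply: eq_big_seq => c cD.
by rewrite hook_tab.
Qed.
End Tableau.

Lemma qvar_generic (R : realType) : generic (qvar R).
Proof.
have X1 m : (('X : {poly R[i]}) ^+ m.+1) <> 1.
  by move=> e; have := congr1 (fun p : {poly R[i]} => size p) e; rewrite /= size_polyXn size_poly1.
have qX m : qvar R ^+ m.+1 <> 1.
  by rewrite /qvar -tofracXn -tofrac1 => /eqP; rewrite tofrac_eq => /eqP/X1.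
split=> [|[[|m]|m] // e].
- by rewrite /qvar tofrac_eq0 polyX_eq0.
- by case: (qX m).
by case: (qX m); apply: invr_inj; rewrite invr1.
Qed.

Theorem theorem3p3 (R : realType) (n : nat) (lam : seq nat) (t : cell -> nat) :
  (1 <= n)%N -> is_partition lam -> sumn lam = n -> is_standard lam t ->
  exists (Phi : nat -> hfun (qvar R) n) (v : hecke (qvar R) n),
    [/\ Phi 0%N = Psi (qvar R) n,
        forall k : 'I_n,
          hfun_eval k (qcontent (qvar R) (cell_of (diagram lam) t k.+1))
            (Phi k) (Phi k.+1),
        Phi n = tens1 (ratconst (Cq R) n) v
      & idem (qvar R) n n (diagram lam) t = fcoef (qvar R) lam *: v].
Proof.
move=> n0 lamP En tS; subst n; set n := sumn lam in n0 *.
set q := qvar R; set D := diagram lam; set cl := cell_of D t.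
have qG : generic q := qvar_generic R.
have sT : std (tab cl n) := tab_std_of lamP tS (leqnn n).
have sTm m : (m < n)%N -> std (tab cl m) by move=> mn; apply: tab_std_of => //; apply: ltnW.
have Lu m : (m < n)%N -> uniq (tabroots lam t m).
  by move=> mn; apply/addable_cells_content_uniq/sTm.
have La m c : (m < n)%N -> addcell (tab cl m) c -> content c \in tabroots lam t m.
  by move=> mn /(mem_addable_cells _ (sTm m mn))/(map_f content).
(* The last function is constant; its value [v] is the idempotent divided by f(lambda). *)
exists (Phi q n cl (tabroots lam t)), ((fD q (tab cl n))^-1 *: idemE q n cl (tabroots lam t) n).
split.
- exact: (Phi0 _ _ _ n0).
- move=> k; apply: heval_hfun_eval => //; exact: (heval_Phi qG n0 sT Lu La k).
- exact: (PhiN _ _ _ n0).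
have f0 : fD q (tab cl n) != 0 by exact: (fD_neq0 qG n0 sT (leqnn n)).
rewrite scalerA (fcoef_tab lamP tS) mulfV // scale1r.
by apply: (idem_tab lamP tS) => //; rewrite perm_sym; apply: tab_perm.
Qed.
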